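(* Let $\alpha\in(0,2)$, $\alpha\ne1$, $c>0$, and suppose $W_1\sim\mathcal{N}(0,\sigma_W^2)$ with $\sigma_W>0$. For $s\in\mathbb{R}$ denote $$a:=\frac\alpha2,\quad \eta:=\frac{1-a}{a},\quad w:=\frac{\eta s^2}{2c},\quad u:=wS^2_{(c,\infty)},\quad\text{where } S^2_{(c,\infty)}=\sigma_W^2\frac{\alpha}{2-\alpha}c^{\frac{\alpha-2}{\alpha}}.$$ Then, with $Z_{(c,\infty)}$ and $X_{(0,c)}$ as in the context, their characteristic functions satisfy $$\phi_{Z_{(c,\infty)}}(s)=\exp\left(c\left(1-e^{-w}-w^a\gamma(1-a,w)\right)\right)$$ and $$\phi_{X_{(0,c)}}(s)=\exp\left(-c\left(1-e^{-u}+u^a\Gamma(1-a,u)\right)\right).$$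
   Context: Lower and upper incomplete gamma functions: $\gamma(s,x)=\int_0^x t^{s-1}e^{-t}\,dt$ and $\Gamma(s,x)=\int_x^\infty t^{s-1}e^{-t}\,dt$. Let $\{\Gamma_j\}_{j\ge1}$ be the successive arrival times of a unit rate Poisson process on $(0,\infty)$ and let $\{W_j\}_{j\ge1}$ be i.i.d. $\mathcal{N}(0,\sigma_W^2)$ independent of $\{\Gamma_j\}$. For $c>0$ let $X_{(0,c)}:=\sum_{j:\Gamma_j\in[0,c]}W_j\Gamma_j^{-1/\alpha}$ (an empty sum is $0$). Let $R_{(c,\infty)}$ be the limit in distribution, as $d\to\infty$, of $R_{(c,d)}:=\sum_{j:\Gamma_j\in(c,d)}W_j\Gamma_j^{-1/\alpha}$ (this limit exists), and $Z_{(c,\infty)}:=R_{(c,\infty)}/S_{(c,\infty)}$ with $S_{(c,\infty)}=\sqrt{S^2_{(c,\infty)}}$. *)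

(* Defs.v *)
From HB Require Import structures.
From mathcomp Require Import all_boot all_order all_algebra.
From mathcomp Require Import finmap complex.
From mathcomp Require Import all_classical all_reals all_analysis.

Set Implicit Arguments.
Unset Strict Implicit.
Unset Printing Implicit Defensive.

Import Order.TTheory GRing.Theory Num.Theory.
Import numFieldNormedType.Exports.

Local Open Scope classical_set_scope.
Local Open Scope ring_scope.

Definition lower_gamma (R : realType) (s x : R) : R :=
  \int[@lebesgue_measure R]_(t in `]0, x]) (t `^ (s - 1) * expR (- t)).

Definition upper_gamma (R : realType) (s x : R) : R :=
  \int[@lebesgue_measure R]_(t in `]x, +oo[) (t `^ (s - 1) * expR (- t)).

(* The expectation of a complex random variable is taken componentwise. *)
Definition complex_expectation d (T : measurableType d) (R : realType)
    (P : probability T R) (F : T -> R[i]) : R[i] :=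
  Complex (fine 'E_P[fun w => complex.Re (F w)])
          (fine 'E_P[fun w => complex.Im (F w)]).

(* The complex exponential of the imaginary number i t. *)
Definition expi (R : realType) (t : R) : R[i] := Complex (cos t) (sin t).

Definition char_fun d (T : measurableType d) (R : realType)
    (P : probability T R) (X : T -> R) (s : R) : R[i] :=
  complex_expectation P (fun w => expi (s * X w)).

Definition cvg_in_distribution (R : realType)
    d (T : measurableType d) (P : probability T R) (X : R -> T -> R)
    d' (T' : measurableType d') (P' : probability T' R) (Y : T' -> R) : Prop :=
  forall f : R -> R, continuous f -> (exists M : R, forall x, `|f x| <= M) ->
    'E_P[f \o X t]%E @[t --> +oo] --> 'E_P'[f \o Y]%E.

Definition mutually_independent d (T : measurableType d) (R : realType)
    (P : probability T R) d' (U : measurableType d') (I : choiceType)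
    (X : I -> T -> U) : Prop :=
  forall (J : {fset I}) (B : I -> set U), (forall i, measurable (B i)) ->
    P (\bigcap_(i in [set` J]) (X i @^-1` B i)) =
    (\prod_(i <- J) P (X i @^-1` B i))%E.

Definition generated_sigma_algebra (T : Type) d' (U : measurableType d')
    (I : Type) (X : I -> T -> U) : set (set T) :=
  <<s \bigcup_i preimage_set_system [set: T] (X i) measurable >>.

Definition independent_families d (T : measurableType d) (R : realType)
    (P : probability T R) d1 (U1 : measurableType d1) d2 (U2 : measurableType d2)
    (I1 I2 : Type) (X : I1 -> T -> U1) (Y : I2 -> T -> U2) : Prop :=
  forall A B, generated_sigma_algebra X A -> generated_sigma_algebra Y B ->
    P (A `&` B) = (P A * P B)%E.

(* Time ranges over [0, +oo[; the values of N at negative times are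
   irrelevant.  The subtractions are truncated, but the paths of N are
   nondecreasing almost surely. *)
Record poisson_process d (T : measurableType d) (R : realType)
    (P : probability T R) (rate : R) (N : R -> {RV P >-> nat}) : Prop := {
  poisson_process_start : {ae P, forall w, N 0 w = 0%N} ;
  poisson_process_nondecreasing : {ae P, forall w, forall s t : R,
    0 <= s -> s <= t -> (N s w <= N t w)%N} ;
  poisson_process_right_continuous : {ae P, forall w, forall t : R, 0 <= t ->
    \forall u \near t^'+, N u w = N t w} ;
  poisson_process_independent_increments : forall t : nat -> R,
    0 <= t 0%N -> {homo t : i j / (i <= j)%N >-> i <= j} ->
    mutually_independent P (fun i w => (N (t i.+1) w - N (t i) w)%N) ;
  poisson_process_increments : forall s t : R, 0 <= s -> s < t -> forall k,
    P [set w | (N t w - N s w)%N = k] = (poisson_pmf (rate * (t - s)) k)%:E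
}.

(* Indices are shifted by one: G j is the (j+1)-st arrival time of N, i.e.
   the first time at which N is at least j+1. *)
Definition arrival_times d (T : measurableType d) (R : realType)
    (P : probability T R) (N : R -> {RV P >-> nat}) (G : nat -> {RV P >-> R}) :
    Prop :=
  {ae P, forall w, forall j, G j w = inf [set t : R | 0 <= t /\ (j < N t w)%N]}.

Definition iid_centered_normal d (T : measurableType d) (R : realType)
    (P : probability T R) (sigma : R) (W : nat -> {RV P >-> R}) : Prop :=
  mutually_independent P (fun j => W j : T -> R) /\
  forall j (B : set R), measurable B ->
    distribution P (W j) B = normal_prob 0 sigma B.

(* The sum of W j * (G j)^(-1/alpha) over the j with G j in I.  When I is
   bounded it has finitely many terms almost surely; the sum over an infinite
   support is 0 by convention. *)
Definition shot_noise (T : Type) (R : realType) (alpha : R)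
    (W G : nat -> T -> R) (I : set R) (w : T) : R :=
  \sum_(j \in [set j | I (G j w)]) W j w * G j w `^ (- alpha^-1).

(* Main.v *)
(* Conditionally on the arrival times the sum is centred Gaussian, so peeling off
   the W_j one at a time turns E cos (s X + th) into
   cos th * E prod_j h(G_j), with h(x) = exp (- k x^(-1/a)),
   k = sigma^2 s^2 / 2 and a = alpha / 2; taking th = - pi / 2 gives the sine.
   As h is nondecreasing, prod_j h(G_j) over G_j in ]p, q] lies between the
   products of h(t_i)^(N t_(i+1) - N t_i) and of h(t_(i+1))^(N t_(i+1) - N t_i)
   for every partition of [p, q], whose expectations are exponentials of
   Riemann sums of - (1 - h); hence E prod_j h(G_j) = exp (- int_p^q (1 - h)).
   That integral is never formed: it suffices to have a function K with
   (1 - h y) (y - x) <= K y - K x <= (1 - h x) (y - x), and the closed forms with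
   incomplete gamma functions have this property by bounding t^(-a) on
   [k y^(-1/a), k x^(-1/a)]. The tail statement follows by letting the right
   end of the window tend to infinity. *)

Require Import Defs.
From HB Require Import structures.
From mathcomp Require Import all_boot all_order all_algebra.
From mathcomp Require Import finmap complex.
From mathcomp Require Import all_classical all_reals all_analysis.
From mathcomp Require Import measurable_realfun ring lra.

Set Implicit Arguments.
Unset Strict Implicit.
Unset Printing Implicit Defensive.

Import Order.TTheory GRing.Theory Num.Theory.
Import numFieldNormedType.Exports.

Local Open Scope classical_set_scope.
Local Open Scope ring_scope.

(** * Independence of the past *)

(** The number of arrivals in a window is random and unbounded, while peeling off the W_j needs a
    deterministic number of summands. Hence sums and products run over the first n arrivals,
    membership in the window enters as a factor ([window]) that is 0 outside, and the error is at
    most a multiple of the probability of more than n arrivals, which vanishes as n grows. Counting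
    identifies arrivals in half-open intervals ]x, y] exactly; the open window ]c, D[ of the tail is
    therefore squeezed between ]c, D - 1] and ]c, D]. The two closed forms come from integrating 1 -
    h by parts and substituting t = k x^(-1/a). They differ on the positive axis by the constant k^a
    Gamma(1 - a): the upper incomplete gamma function belongs to the primitive that vanishes at 0,
    the lower one to the primitive that vanishes at infinity. The latter exists because 1 - h decays
    like x^(-1/a) with 1/a > 1, that is, alpha < 2. *)

Lemma integrable_bounded d (T : measurableType d) (R : realType)
    (P : probability T R) (f : T -> R) (M : R) :
  measurable_fun setT f -> (forall x, `|f x| <= M) ->
  P.-integrable setT (EFin \o f).
Proof.
move=> mf fM; apply: measurable_bounded_integrable => //.
  by rewrite [X in (X < _)%E]probability_setT ltry.
exists M; split; first exact: num_real.
by move=> N MN x _; apply: le_trans (fM x) (ltW MN).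
Qed.

(** Independence makes the law of the pair agree with the product of the laws on rectangles, hence
    everywhere; Fubini then freezes [Y]. The inner integral is kept against the law of [V] so that
    this law can be replaced by an explicit one. *)
Lemma integral_independent_pair d (T : measurableType d) (R : realType)
    (P : probability T R) d1 (E : measurableType d1) d2 (F : measurableType d2)
    (Y : {mfun T >-> E}) (V : {mfun T >-> F}) (f : E * F -> R) (M : R) :
  (forall A B, measurable A -> measurable B ->
    P (Y @^-1` A `&` V @^-1` B) = (P (Y @^-1` A) * P (V @^-1` B))%E) ->
  measurable_fun setT f -> (forall z, `|f z| <= M) ->
  (\int[P]_w (f (Y w, V w))%:E =
   \int[P]_w \int[distribution P V]_v (f (Y w, v))%:E)%E.
Proof.
move=> ind mf fM.
have mYV : measurable_fun setT (fun w => (Y w, V w)).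
  by apply/measurable_fun_pairP; split; exact: measurable_funPT.
pose YV : {mfun T >-> (E * F)%type} :=
  HB.pack (fun w => (Y w, V w)) (isMeasurableFun.Build _ _ _ _ _ mYV).
have fi := integrable_bounded P (measurableT_comp mf mYV) (fun w => fM (Y w, V w)).
transitivity (\int[distribution P YV]_z (f z)%:E)%E.
  rewrite (@integral_distribution _ _ _ _ _ P YV (EFin \o f))//.
  exact/measurable_EFinP.
transitivity (\int[(distribution P Y \x distribution P V)%E]_z (f z)%:E)%E.
  apply: eq_measure_integral => A mA _; apply/esym.
  apply: (@product_measure_unique _ _ _ _ _ (distribution P Y)
    (distribution P V) (distribution P YV)) => // B C mB mC; exact: ind.
have fi2 : (distribution P Y \x distribution P V)%E.-integrable setT (EFin \o f).
  apply: measurable_bounded_integrable => //.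
    rewrite (_ : [set: (E * F)%type] = [set: E] `*` [set: F]); last by rewrite setXTT.
    by rewrite [X in (X < _)%E]product_measure1E//= !probability_setT mule1 ltry.
  exists M; split; first exact: num_real.
  by move=> N MN x _; apply: le_trans (fM x) (ltW MN).
rewrite -(integral12_prod_meas1 fi2).
rewrite (@integral_distribution _ _ _ _ _ P Y
  (fun y => \int[distribution P V]_v (f (y, v))%:E)%E)//.
  exact: (measurable_fubini_F fi2).
apply/integrableP; split.
  by apply: measurableT_comp => //; exact: (measurable_fubini_F fi2).
apply: (@le_lt_trans _ _ (\int[P]_x `|M|%:E)%E); last first.
  by rewrite integral_cst//= probability_setT mule1 ltry.
apply: ge0_le_integral => //.
  by do 2 apply: measurableT_comp => //; exact: (measurable_fubini_F fi2).
move=> w _ /=.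
have mfw : measurable_fun setT (fun v => f (Y w, v)).
  exact: measurableT_comp.
apply: le_trans (le_abse_integral _ _ _) _ => //.
  exact/measurable_EFinP.
apply: (@le_trans _ _ (\int[distribution P V]_v `|M|%:E)%E).
  apply: ge0_le_integral => //.
    by apply: measurableT_comp => //; exact/measurable_EFinP.
  by move=> v _; rewrite lee_fin (le_trans (fM _))// ler_norm.
by rewrite integral_cst//= probability_setT mule1.
Qed.

(* A pi-system generating the sigma-algebra of C and the X i with i < n. *)
Definition past (T : Type) d' (U : measurableType d') (X : nat -> T -> U)
    (C : set (set T)) (n : nat) : set (set T) :=
  [set E | exists2 B : nat -> set U, (forall i, measurable (B i)) &
     exists2 D, C D & E = D `&` \bigcap_(i < n) (X i @^-1` B i)].

(** Uniqueness of finite measures on a pi-system. [C] carries the events of a second family, later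
    the arrival times; a trivial [C] recovers plain mutual independence. *)
Lemma independent_past d (T : measurableType d) (R : realType)
    (P : probability T R) d' (U : measurableType d') (X : nat -> T -> U)
    (C : set (set T)) (n : nat) :
  (forall i, measurable_fun setT (X i)) -> mutually_independent P X ->
  C `<=` measurable -> setI_closed C -> C setT ->
  (forall A D, generated_sigma_algebra X A -> C D ->
    P (A `&` D) = (P A * P D)%E) ->
  forall E B, <<s past X C n >> E -> measurable B ->
  P (E `&` X n @^-1` B) = (P E * P (X n @^-1` B))%E.
Proof.
move=> mX indX Cm CI CT indC E B sE mB.
have mpre i A : measurable A -> measurable (X i @^-1` A).
  by move=> mA; rewrite -[X in measurable X]setTI; exact: mX.
have gX i A : measurable A -> generated_sigma_algebra X (X i @^-1` A).
  move=> mA; apply: sub_sigma_algebra; exists i => //.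
  by exists A => //; rewrite setTI.
have gcap (k : nat) (A : nat -> set U) : (forall i, measurable (A i)) ->
    generated_sigma_algebra X (\bigcap_(i < k) X i @^-1` A i).
  move=> mA; rewrite /generated_sigma_algebra.
  set GG := \bigcup_i _.
  have -> : \bigcap_(i < k) X i @^-1` A i =
     \bigcap_i (if (i < k)%N then X i @^-1` A i else setT).
    apply/seteqP; split => w /= h i.
      by move=> _; case: ifPn => // ik; exact: h.
    by move=> ik; move: (h i I); rewrite ik.
  apply: (@bigcapT_measurable _ (g_sigma_algebraType GG)) => i.
  case: ifPn => _; last exact: (@measurableT _ (g_sigma_algebraType GG)).
  exact: gX.
have Pcap (k : nat) (A : nat -> set U) : (forall i, measurable (A i)) ->
    P (\bigcap_(i < k) X i @^-1` A i) = (\prod_(i < k) P (X i @^-1` A i))%E.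
  move=> mA; have := indX [fset i | i in iota 0 k]%fset A mA.
  have -> : [set` [fset i | i in iota 0 k]%fset] = `I_k.
    apply/seteqP; split => i /=.
      by move=> /imfsetP[j /=]; rewrite mem_iota add0n => /andP[_ jk] ->.
    by move=> ik; apply/imfsetP; exists i => //=; rewrite mem_iota.
  move=> ->; rewrite big_imfset//=; transitivity (\prod_(0 <= i < k) P (X i @^-1` A i))%E.
    by rewrite /index_iota subn0 undup_id// iota_uniq.
  by rewrite big_mkord.
have setIpast : setI_closed (past X C n).
  move=> _ _ [B1 mB1 [D1 CD1 ->]] [B2 mB2 [D2 CD2 ->]].
  exists (fun i => B1 i `&` B2 i); first by move=> i; exact: measurableI.
  exists (D1 `&` D2); first exact: CI.
  by rewrite setIACA -bigcapI.
have past_m : past X C n `<=` measurable.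
  move=> _ [A mA [D CD ->]]; apply: measurableI; first exact: Cm.
  by apply: bigcap_measurableType => i _; exact: mpre.
have pastT : past X C n setT.
  exists (fun=> setT) => //; exists setT => //.
  by rewrite setTI; apply/seteqP; split.
(* As functions of [E], both sides are finite measures, [mrestr P] and [mscale k P], so it suffices
   to compare them on the generating pi-system. *)
pose k : {nonneg R} := NngNum (fine_ge0 (measure_ge0 P (X n @^-1` B))).
have kE : (k%:num%:E = P (X n @^-1` B))%E by rewrite /= fineK// fin_num_measure//; exact: mpre.
have -> : P (E `&` X n @^-1` B) = mrestr P (mpre n B mB) E by [].
rewrite muleC -kE.
have -> : (k%:num%:E * P E)%E = mscale k P E by [].
apply: (g_sigma_algebra_measure_unique (past X C n) past_m (fun=> setT)) => //.
- by apply/seteqP; split => // w _; exists 0%N.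
- move=> _ [A mA [D CD ->]].
  rewrite [LHS]/= [RHS]/=; set D' := _ `&` _.
  have -> : mscale k P D' = (P (X n @^-1` B) * P D')%E by rewrite -kE.
  rewrite /mrestr {}/D'.
  (* Putting [B] into slot n turns the event into [D] and a block of n + 1 coordinates: [indC]
     splits off [D], mutual independence factors the block. *)
  pose A' i := if i == n then B else A i.
  have mA' i : measurable (A' i) by rewrite /A'; case: ifP.
  have capE : (\bigcap_(i < n) X i @^-1` A i) `&` X n @^-1` B =
              \bigcap_(i < n.+1) X i @^-1` A' i.
    rewrite bigcap_mkord bigcap_mkord big_ord_recr/= /A' eqxx; congr (_ `&` _).
    by apply: eq_bigr => i _; rewrite ltn_eqF ?ltn_ord.
  rewrite -setIA capE !(setIC D) indC//; last exact: gcap.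
  rewrite indC//; last exact: gcap.
  rewrite !Pcap// big_ord_recr/= /A' eqxx.
  rewrite muleA (muleC (\prod_(i < n) _)%E); congr (_ * _ * _)%E.
  by apply: eq_bigr => i _; rewrite ltn_eqF ?ltn_ord.
- by move=> _; rewrite /= /mrestr setTI ltey_eq fin_num_measure//; exact: mpre.
Qed.

(** * Characteristic function of the normal law *)

(** The change of variables yields the Radon-Nikodym derivative, which is determined only almost
    everywhere; it is identified with [normal_pdf] by equal integrals over measurable sets. *)
Lemma integral_normal_prob (R : realType) (m s : R) (f : R -> \bar R) :
  (normal_prob m s).-integrable setT f ->
  (\int[normal_prob m s]_x f x =
   \int[@lebesgue_measure R]_x (f x * (normal_pdf m s x)%:E))%E.
Proof.
move=> intf; have mf := measurable_int _ intf.
rewrite -(Radon_Nikodym_change_of_variables (normal_prob_dominates m s))//=.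
have mpdf : measurable_fun setT (EFin \o normal_pdf m s).
  by apply/measurable_EFinP; exact: measurable_normal_pdf.
apply: ae_eq_integral => //.
- apply: emeasurable_funM => //; apply: (measurable_int lebesgue_measure).
  by apply: Radon_Nikodym_integrable; exact: normal_prob_dominates.
- exact: emeasurable_funM.
- apply: ae_eqe_mul2l => /=.
  rewrite Radon_NikodymE//=; first exact: normal_prob_dominates.
  move=> dom; case: cid => /= h [h1 h2 h3].
  apply: integral_ae_eq => //=.
  by move=> E E01 mE; rewrite -h3.
Qed.

Lemma integral_is_derive (R : realType) (F f : R -> R) (a b : R) : a < b ->
  (forall x : R, is_derive x 1 F (f x)) -> continuous f ->
  (\int[@lebesgue_measure R]_(x in `[a, b]) (f x)%:E = (F b - F a)%:E)%E.
Proof.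
move=> ab dF cf.
have cF : continuous F.
  move=> x; apply/differentiable_continuous/derivable1_diffP.
  exact: (@ex_derive _ _ _ _ _ _ _ (dF x)).
rewrite (@continuous_FTC2 _ f F)//.
- exact: continuous_subspaceT.
- split; [by move=> x _; exact: (@ex_derive _ _ _ _ _ _ _ (dF x))|..].
  + exact/cvg_at_right_filter/cF.
  + exact/cvg_at_left_filter/cF.
- by move=> x _; rewrite derive1E; exact: (@derive_val _ _ _ _ _ _ _ (dF x)).
Qed.

(** Integration by parts on the whole line in disguise: [F] will be a product whose boundary terms
    vanish. Dominated convergence reduces to the intervals [-n, n]. *)
Lemma integral_is_derive_vanishing (R : realType) (F f : R -> R) :
  (forall x : R, is_derive x 1 F (f x)) -> continuous f ->
  (@lebesgue_measure R).-integrable setT (EFin \o f) ->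
  F n%:R - F (- n%:R) @[n --> \oo] --> 0 ->
  \int[@lebesgue_measure R]_x f x = 0.
Proof.
move=> dF cf fi F0.
have mf : measurable_fun setT f by exact: continuous_measurable_fun.
pose D (n : nat) : set R := `[- n%:R, n%:R]%classic.
have mfD n : measurable_fun setT (EFin \o (f \_ (D n))).
  apply/measurable_EFinP; apply/(measurable_restrictT f).
    exact: measurable_itv.
  exact: measurable_funTS.
have h : (\int[@lebesgue_measure R]_x ((EFin \o (f \_ (D n))) x))%E @[n --> \oo] -->
   (\int[@lebesgue_measure R]_x (f x)%:E)%E.
  apply: (@dominated_cvg _ _ _ (@lebesgue_measure R) setT measurableT
    (fun n => EFin \o (f \_ (D n))) (EFin \o f) (abse \o (EFin \o f))) => //.
  - move=> x _; apply: cvg_near_cst.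
    near=> n; rewrite /= patchE ifT// inE /D/= in_itv/= -ler_norml.
    by near: n; exact: nbhs_infty_ger.
  - exact: integrable_abse.
  - move=> n x _ /=; rewrite patchE; case: ifPn => // _.
    by rewrite normr0 lee_fin.
rewrite /Rintegral (_ : (\int[_]_x _)%E = 0%:E)//.
apply/esym; apply: (cvg_unique _ _ h) => //.
have -> : (fun n => \int[@lebesgue_measure R]_x ((EFin \o (f \_ (D n))) x))%E =
    (fun n => (F n%:R - F (- n%:R))%:E).
  (* For n = 0 the interval is a single point, whereas [integral_is_derive] requires a < b. *)
  apply/funext => -[|n].
    rewrite -restrict_EFin -integral_mkcond /D oppr0 set_itv1 integral_set1.
    by rewrite subrr.
  rewrite -restrict_EFin -integral_mkcond (@integral_is_derive _ F)//.
  by rewrite gtrN.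
by apply: cvg_EFin => //; exact: nearW.
Unshelve. all: by end_near. Qed.

Lemma normal_pdf_derive (R : realType) (s x : R) : s != 0 ->
  is_derive x 1 (normal_pdf 0 s) (- (x / s ^+ 2) * normal_pdf 0 s x).
Proof.
move=> s0; rewrite normal_pdfE// /normal_fun.
apply: is_derive_eq; rewrite /GRing.scale/=.
by field; rewrite s0.
Qed.

Lemma normal_pdfN (R : realType) (s x : R) : s != 0 ->
  normal_pdf 0 s (- x) = normal_pdf 0 s x.
Proof. by move=> s0; rewrite normal_pdfE// /normal_fun !subr0 sqrrN. Qed.

Lemma normal_pdf_cvg0 (R : realType) (s : R) : s != 0 ->
  normal_pdf 0 s x @[x --> +oo] --> 0.
Proof.
move=> s0; rewrite normal_pdfE// /normal_fun.
rewrite -[X in _ --> X](mulr0 (normal_peak s)); apply: cvgMr.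
under eq_fun do rewrite subr0 mulNr.
apply: (@cvg_comp _ _ _ (fun x : R => x ^+ 2 / (s ^+ 2 *+ 2)) (fun x => expR (- x))
  _ +oo); last exact: cvgr_expR.
apply: gt0_cvgMly; last exact: cvgr_expr2.
by rewrite invr_gt0 pmulrn_lgt0// exprn_even_gt0.
Qed.

(** By symmetry the half line suffices, and there - s^2 times the density is a primitive. This
    function dominates the derivative in the parameter when differentiating under the integral
    below. *)
Lemma integrable_normr_normal_pdf (R : realType) (s : R) : s != 0 ->
  (@lebesgue_measure R).-integrable setT (fun x => (`|x| * normal_pdf 0 s x)%:E).
Proof.
move=> s0.
have c1 : continuous (fun x : R => `|x| * normal_pdf 0 s x).
  move=> x; apply: cvgM; last exact: continuous_normal_pdf.
  exact: norm_continuous.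
have g0 x : 0 <= `|x| * normal_pdf 0 s x by rewrite mulr_ge0// normal_pdf_ge0.
apply/integrableP; split.
  by apply/measurable_EFinP; exact: continuous_measurable_fun.
under eq_integral do rewrite /= ger0_norm//.
rewrite ge0_symfun_integralT//; last first.
  by move=> x; rewrite /= normrN normal_pdfN.
rewrite -set_itvcy.
rewrite (@ge0_continuous_FTC2y _ _ (fun x => - s ^+ 2 * normal_pdf 0 s x) 0 0)//.
- by rewrite -EFinB -EFinM ltry.
- exact: continuous_subspaceT.
- by rewrite -[X in _ --> X](mulr0 (- s ^+ 2)); apply: cvgMr; exact: normal_pdf_cvg0.
- move=> x _.
  apply: derivableM => //; exact: (@ex_derive _ _ _ _ _ _ _ (normal_pdf_derive _ s0)).
- apply: cvg_at_right_filter; apply: cvgMr; exact: continuous_normal_pdf.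
- move=> x; rewrite in_itv/= andbT => x0.
  have d := normal_pdf_derive x s0.
  rewrite derive1E deriveM//= !derive_val.
  rewrite /GRing.scale/= ger0_norm ?ltW//.
  by field; rewrite s0.
Qed.


(** As a function phi of t, the integral solves phi' = - s^2 t phi. The phase [th] serves cosine and
    sine at once, and later holds the part of the sum that is not yet integrated. *)
Lemma cos_normal_pdf_integral (R : realType) (s th t : R) : s != 0 ->
  \int[@lebesgue_measure R]_x (cos (t * x + th) * normal_pdf 0 s x) =
  cos th * expR (- (s ^+ 2 * t ^+ 2 / 2)).
Proof.
move=> s0.
have ccs (a b : R) (g : R -> R) : continuous g -> continuous (fun x => g (a * x + b)).
  move=> cg x; apply: (@continuous_comp _ _ _ (fun x => a * x + b) g); last exact: cg.
  apply: cvgD; last exact: cvg_cst.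
  by apply: cvgMr; exact: cvg_id.
have ctrig : forall g : R -> R, continuous g -> (forall x, `|g x| <= 1) -> forall a b,
    (@lebesgue_measure R).-integrable setT
      (fun x => (`|x| * (g (a * x + b) * normal_pdf 0 s x))%:E) /\
    (@lebesgue_measure R).-integrable setT
      (fun x => (g (a * x + b) * normal_pdf 0 s x)%:E).
  move=> g cg g1 a b; split.
    apply: (le_integrable _ _ _ (integrable_normr_normal_pdf s0)) => //.
      apply/measurable_EFinP; apply: continuous_measurable_fun => x.
      apply: cvgM; first exact: norm_continuous.
      by apply: cvgM; [exact: ccs|exact: continuous_normal_pdf].
    move=> x _; rewrite lee_fin !normrM normr_id ler_wpM2l//.
    by rewrite -[leRHS]mul1r ler_wpM2r.
  apply: (le_integrable _ _ _ (integrable_normal_pdf 0 s)) => //.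
    apply/measurable_EFinP; apply: continuous_measurable_fun => x.
    by apply: cvgM; [exact: ccs|exact: continuous_normal_pdf].
  by move=> x _; rewrite lee_fin normrM -[leRHS]mul1r ler_wpM2r.
have icos := ctrig cos (@continuous_cos R) (@cos_max R).
have isin := ctrig sin (@continuous_sin R) (@sin_max R).
have ixsin (u : R) : (@lebesgue_measure R).-integrable setT
    (fun x => (x * (sin (u * x + th) * normal_pdf 0 s x))%:E).
  apply: (le_integrable _ _ _ (isin u th).1) => //.
    apply/measurable_EFinP; apply: continuous_measurable_fun => x.
    apply: cvgM; first exact: cvg_id.
    by apply: cvgM; [exact/ccs/continuous_sin|exact: continuous_normal_pdf].
  by move=> x _; rewrite lee_fin !normrM normr_id.
pose phi (u : R) := \int[@lebesgue_measure R]_x (cos (u * x + th) * normal_pdf 0 s x).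
have dphi (u : R) : is_derive u 1 phi (- (s ^+ 2) * u * phi u).
  have du (v x : R) : is_derive v 1 (fun v => cos (v * x + th) * normal_pdf 0 s x)
      (- (x * (sin (v * x + th) * normal_pdf 0 s x))).
    apply: is_derive_eq; rewrite /GRing.scale/=; ring.
  have phi_der : is_derive u 1 phi
      (- \int[@lebesgue_measure R]_x (x * (sin (u * x + th) * normal_pdf 0 s x))).
    have u_itv : u \in `]u - 1, u + 1[ by rewrite in_itv/= ltrBlDr !ltrDl ltr01.
    have d1E : partial1of2 (fun u x => cos (u * x + th) * normal_pdf 0 s x) =
        fun v x => - (x * (sin (v * x + th) * normal_pdf 0 s x)).
      apply/funext => v; apply/funext => x; rewrite /partial1of2 derive1E.
      exact: (@derive_val _ _ _ _ _ _ _ (du v x)).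
    have der1 (v x : R) : derivable (fun v : R => cos (v * x + th) * normal_pdf 0 s x) v 1.
      exact: (@ex_derive _ _ _ _ _ _ _ (du v x)).
    have G0 (x : R) : 0 <= `|x| * normal_pdf 0 s x by rewrite mulr_ge0// normal_pdf_ge0.
    have Gub (v x : R) :
        `|partial1of2 (fun u x => cos (u * x + th) * normal_pdf 0 s x) v x| <=
        `|x| * normal_pdf 0 s x.
      rewrite d1E normrN !normrM ler_wpM2l// -[leRHS]mul1r (ger0_norm (normal_pdf_ge0 _ _ _)).
      by rewrite ler_wpM2r ?normal_pdf_ge0// sin_max.
    apply: (@DeriveDef).
      exact: (derivable_under_integral measurableT u_itv
        (fun v _ => (icos v th).2) (fun v x _ _ => der1 v x) G0
        (integrable_normr_normal_pdf s0) (fun v x _ _ => Gub v x)).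
    rewrite -derive1E (differentiation_under_integral measurableT u_itv
        (fun v _ => (icos v th).2) (fun v x _ _ => der1 v x) G0
        (integrable_normr_normal_pdf s0) (fun v x _ _ => Gub v x)).
    rewrite d1E -mulN1r -RintegralZl//; last exact: ixsin.
    by apply: eq_Rintegral => x _; rewrite mulN1r.
  suff <- : - (\int[@lebesgue_measure R]_x (x * (sin (u * x + th) * normal_pdf 0 s x))) =
    - (s ^+ 2) * u * phi u by [].
  (* The integral of this derivative over the line is 0, which expresses the integral of x sin(u x +
     th) against the density as s^2 u phi(u). *)
  have dF (x : R) : is_derive x 1 (fun x => sin (u * x + th) * normal_pdf 0 s x)
     (u * (cos (u * x + th) * normal_pdf 0 s x) -
       s ^- 2 * (x * (sin (u * x + th) * normal_pdf 0 s x))).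
    have d := normal_pdf_derive x s0.
    apply: is_derive_eq; rewrite /GRing.scale/=.
    by field; rewrite s0.
  have i1 := integrableZl measurableT u (icos u th).2.
  have i2 := integrableZl measurableT (s ^- 2) (ixsin u).
  have h := integral_is_derive_vanishing dF.
  suff : u * phi u - s ^- 2 *
      (\int[@lebesgue_measure R]_x (x * (sin (u * x + th) * normal_pdf 0 s x))) = 0.
    move/eqP; rewrite subr_eq0 => /eqP E; rewrite !mulNr; congr (- _).
    by rewrite -mulrA E mulrA divff ?mul1r// expf_neq0.
  rewrite -[LHS]/(u * (\int[@lebesgue_measure R]_x _) - _).
  rewrite -(RintegralZl u measurableT (icos u th).2).
  rewrite -(RintegralZl (s ^- 2) measurableT (ixsin u)).
  rewrite -RintegralB//.
  apply: h.
  - move=> x; apply: cvgB; apply: cvgMr; last (apply: cvgM; first exact: cvg_id).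
    + by apply: cvgM; [exact/ccs/continuous_cos|exact: continuous_normal_pdf].
    + by apply: cvgM; [exact/ccs/continuous_sin|exact: continuous_normal_pdf].
  - exact: (integrableB measurableT i1 i2).
  - apply/norm_cvg0P.
    apply: (@squeeze_cvgr _ _ _ _ (cst 0) (fun n => 2 * normal_pdf 0 s n%:R)).
    + apply: nearW => n; rewrite normr_ge0/= (le_trans (ler_normB _ _))//.
      rewrite mulr_natl mulr2n !normrM normal_pdfN// (ger0_norm (normal_pdf_ge0 _ _ _)).
      by rewrite lerD// -[leRHS]mul1r ler_wpM2r ?normal_pdf_ge0// sin_max.
    + exact: cvg_cst.
    + rewrite -[X in _ --> X](mulr0 2); apply: cvgMr.
      exact: (cvg_comp _ _ (@cvgr_idn R) (normal_pdf_cvg0 s0)).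
(* Integrating factor: the product has derivative 0, so it keeps its value cos th at u = 0. *)
have dpsi (u : R) : is_derive u 1 (fun u : R => phi u * expR (s ^+ 2 * u ^+ 2 / 2)) 0.
  have d := dphi u.
  apply: is_derive_eq; rewrite /GRing.scale/=.
  by field.
have phi0 : phi 0 = cos th.
  rewrite /phi; under eq_Rintegral do rewrite mul0r add0r.
  rewrite RintegralZl//; last exact: integrable_normal_pdf.
  by rewrite /Rintegral integral_normal_pdf/= mulr1.
have : phi t * expR (s ^+ 2 * t ^+ 2 / 2) = cos th.
  rewrite -phi0.
  have := is_derive_0_is_cst t 0 dpsi.
  by rewrite expr0n/= mulr0 mul0r expR0 mulr1.
by move=> <-; rewrite -[RHS]mulrA -expRD subrr expR0 mulr1.
Qed.

Lemma measurable_cos_affine (R : realType) (t th : R) :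
  measurable_fun setT (fun x : R => cos (t * x + th)).
Proof.
apply: continuous_measurable_fun => x.
apply: (@continuous_comp _ _ _ (fun x : R => t * x + th) cos); last exact: continuous_cos.
by apply: cvgD; [apply: cvgMr; exact: cvg_id|exact: cvg_cst].
Qed.

Lemma normal_prob_cos (R : realType) (s th t : R) : s != 0 ->
  (\int[normal_prob 0 s]_x (cos (t * x + th))%:E =
   (cos th * expR (- (s ^+ 2 * t ^+ 2 / 2)))%:E)%E.
Proof.
move=> s0.
have cosi := integrable_bounded (normal_prob 0 s) (measurable_cos_affine t th)
  (fun x => cos_max _).
rewrite integral_normal_prob// -cos_normal_pdf_integral// /Rintegral fineK//.
apply: integrable_fin_num => //=.
apply: (le_integrable _ _ _ (integrable_normal_pdf 0 s)) => //.
  apply/measurable_EFinP; apply: measurable_funM; last exact: measurable_normal_pdf.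
  exact: measurable_cos_affine.
move=> x _; rewrite lee_fin normrM -[leRHS]mul1r ler_wpM2r//.
exact: cos_max.
Qed.

(** * Incomplete gamma functions *)

Lemma integral_expRN (R : realType) (p q : R) : p < q ->
  (\int[@lebesgue_measure R]_(t in `]p, q]) (expR (- t))%:E =
   (expR (- p) - expR (- q))%:E)%E.
Proof.
move=> pq.
have dE (x : R) : is_derive x 1 (fun t : R => - expR (- t)) (expR (- x)).
  apply: is_derive_eq; rewrite /GRing.scale/=; ring.
have cE : continuous (fun t : R => expR (- t)).
  move=> x; apply: (@continuous_comp _ _ _ -%R expR); last exact: continuous_expR.
  exact: opp_continuous.
rewrite integral_itv_obnd_cbnd; last first.
  by apply/measurable_EFinP/measurable_funTS; exact: continuous_measurable_fun.
by rewrite (@integral_is_derive _ _ _ _ _ pq dE cE) opprK addrC.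
Qed.

Lemma integral_expRN_infty (R : realType) (p : R) :
  (\int[@lebesgue_measure R]_(t in `]p, +oo[) (expR (- t))%:E = (expR (- p))%:E)%E.
Proof.
have dE (x : R) : is_derive x 1 (fun t : R => - expR (- t)) (expR (- x)).
  apply: is_derive_eq; rewrite /GRing.scale/=; ring.
have cE : continuous (fun t : R => expR (- t)).
  move=> x; apply: (@continuous_comp _ _ _ -%R expR); last exact: continuous_expR.
  exact: opp_continuous.
rewrite integral_itv_obnd_cbnd; last first.
  by apply/measurable_EFinP/measurable_funTS; exact: continuous_measurable_fun.
rewrite (@ge0_continuous_FTC2y _ _ (fun t : R => - expR (- t)) p 0).
- by rewrite EFinN oppeK add0e.
- by move=> x _; exact: expR_ge0.
- exact: continuous_subspaceT.
- by rewrite -oppr0; apply: cvgN; exact: cvgr_expR.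
- by move=> x _; exact: (@ex_derive _ _ _ _ _ _ _ (dE x)).
- by apply: cvg_at_right_filter; apply: cvgN; exact: cE.
- by move=> x _; rewrite derive1E; exact: (@derive_val _ _ _ _ _ _ _ (dE x)).
Qed.

Definition gamma_integrand (R : realType) (s t : R) : R := t `^ (s - 1) * expR (- t).

Lemma gamma_integrand_ge0 (R : realType) (s t : R) : 0 <= gamma_integrand s t.
Proof. by rewrite mulr_ge0 ?powR_ge0 ?expR_ge0. Qed.

Lemma measurable_gamma_integrand (R : realType) (s : R) (D : set R) :
  measurable_fun D (gamma_integrand s).
Proof.
apply/measurable_funTS/measurable_funM; first exact: measurable_powR.
exact: measurableT_comp.
Qed.

Lemma powR_antimono (R : realType) (r x y : R) : r <= 0 -> 0 < x -> x <= y ->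
  y `^ r <= x `^ r.
Proof.
move=> r0 x0 xy; have y0 := lt_le_trans x0 xy.
rewrite -[r]opprK 2!(powRN _ (- r)) lef_pV2 ?posrE ?powR_gt0//.
by rewrite ge0_ler_powR ?nnegrE ?oppr_ge0// ltW.
Qed.

(** For s < 1 the integrand blows up at 0, so ]0, x] is exhausted by compact intervals on which the
    fundamental theorem applies. *)
Lemma integral_powR_le (R : realType) (s x : R) : 0 < s -> 0 < x ->
  (\int[@lebesgue_measure R]_(t in `]0%R, x]) (t `^ (s - 1))%:E <= (x `^ s / s)%:E)%E.
Proof.
move=> s0 x0.
(* [n.+2] keeps the left end strictly below x already for n = 0. *)
pose F n : set R := `[x / n.+2%:R, x]%classic.
have Fpos n : 0 < x / n.+2%:R by rewrite divr_gt0.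
have UF : \bigcup_n F n = `]0, x]%classic.
  apply/seteqP; split => t /=.
    by move=> [n _]; rewrite /F/= !in_itv/= => /andP[h ->]; rewrite (lt_le_trans _ h).
  rewrite in_itv/= => /andP[t0 tx].
  have [n nP] : exists n : nat, x / t < n%:R by eexists; exact: truncnS_gt.
  exists n => //; rewrite /F/= in_itv/= tx andbT ler_pdivrMr// mulrC -ler_pdivrMr//.
  by rewrite (le_trans (ltW nP))// ler_nat -addn2 leq_addr.
rewrite -UF.
have mpow (D : set R) : measurable_fun D (fun t : R => (t `^ (s - 1))%:E).
  by apply/measurable_EFinP/measurable_funTS; exact: measurable_powR.
have := @ge0_nondecreasing_set_cvg_integral _ (measurableTypeR R) R F (fun t => (t `^ (s - 1))%:E)
  (@lebesgue_measure R).
move=> h.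
have {}h : (\int[@lebesgue_measure R]_(t in F n) (t `^ (s - 1))%:E)%E @[n --> \oo] -->
  (\int[@lebesgue_measure R]_(t in \bigcup_n F n) (t `^ (s - 1))%:E)%E.
  apply: h => //.
  - move=> n m nm; apply/subsetPset => t; rewrite /F/= !in_itv/= => /andP[h ->].
    rewrite andbT (le_trans _ h)// ler_pM2l// lef_pV2 ?posrE//.
    by rewrite ler_nat !ltnS.
  - by move=> n; exact: measurable_itv.
  - by move=> n; exact: mpow.
  - by move=> n t _; rewrite lee_fin powR_ge0.
rewrite -(cvg_lim _ h)//; apply: lime_le; first by apply/cvg_ex; eexists; exact: h.
apply: nearW => n.
have xn : x / n.+2%:R < x by rewrite ltr_pdivrMr// ltr_pMr// ltr1n.
have pos t : x / n.+2%:R <= t -> t \in `]0, +oo[.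
  by move=> h1; rewrite in_itv/= andbT (lt_le_trans (Fpos n)).
have dF (t : R) : 0 < t -> is_derive t 1 (fun t : R => t `^ s / s) (t `^ (s - 1)).
  move=> t0; have d := is_derive1_powR s t0.
  apply: is_derive_eq; rewrite /GRing.scale/=.
  by field; rewrite gt_eqF.
have cF t : 0 < t -> {for t, continuous (fun t : R => t `^ s / s)}.
  move=> t0; apply/differentiable_continuous/derivable1_diffP.
  exact: (@ex_derive _ _ _ _ _ _ _ (dF _ t0)).
rewrite (@continuous_FTC2 _ _ (fun t => t `^ s / s))//.
- by rewrite -EFinB lee_fin gerBl divr_ge0 ?powR_ge0// ltW.
- apply: derivable_within_continuous => t; rewrite in_itv/= => /andP[/pos h1 _].
  exact: derivable_powR.
- split.
  + move=> t; rewrite in_itv/= => /andP[/ltW/pos + _]; rewrite in_itv/= andbT => t0.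
    exact: (@ex_derive _ _ _ _ _ _ _ (dF _ t0)).
  + exact/cvg_at_right_filter/cF.
  + exact/cvg_at_left_filter/cF.
- move=> t; rewrite in_itv/= => /andP[/ltW/pos + _]; rewrite in_itv/= andbT => t0.
  by rewrite derive1E; exact: (@derive_val _ _ _ _ _ _ _ (dF _ t0)).
Qed.

Lemma integrable_gamma_integrand_0 (R : realType) (s x : R) : 0 < s -> 0 < x ->
  (@lebesgue_measure R).-integrable `]0, x] (EFin \o gamma_integrand s).
Proof.
move=> s0 x0; apply/integrableP; split.
  apply/measurable_EFinP; exact: measurable_gamma_integrand.
apply: (@le_lt_trans _ _ (\int[@lebesgue_measure R]_(t in `]0%R, x]) (t `^ (s - 1))%:E)%E).
  apply: ge0_le_integral => //.
  - apply/measurable_EFinP/measurableT_comp => //.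
    exact: measurable_gamma_integrand.
  - by apply/measurable_EFinP/measurable_funTS; exact: measurable_powR.
  - move=> t; rewrite /= in_itv/= => /andP[t0 _].
    rewrite lee_fin ger0_norm ?gamma_integrand_ge0// ler_piMr ?powR_ge0//.
    by rewrite -expR0 ler_expR oppr_le0 ltW.
by apply: le_lt_trans (integral_powR_le s0 x0) _; rewrite ltry.
Qed.

Lemma integrable_expRN (R : realType) (p : R) (D : set (measurableTypeR R)) :
  measurable D ->
  D `<=` `]p, +oo[%classic ->
  (@lebesgue_measure R).-integrable D (fun t => (expR (- t))%:E).
Proof.
move=> mD Dp.
have ii : (@lebesgue_measure R).-integrable `]p, +oo[ (fun t => (expR (- t))%:E).
  apply/integrableP; split.
    by apply/measurable_EFinP/measurable_funTS; exact: measurableT_comp.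
  under eq_integral do rewrite gee0_abs ?lee_fin ?expR_ge0//.
  by rewrite integral_expRN_infty ltry.
apply: (@integrableS _ (measurableTypeR R) _ _ `]p, +oo[%classic _ _ _ mD Dp ii).
exact: measurable_itv.
Qed.

Lemma gamma_integrand_le (R : realType) (s p t : R) : s <= 1 -> 0 < p -> p <= t ->
  gamma_integrand s t <= p `^ (s - 1) * expR (- t).
Proof.
move=> s1 p0 pt; rewrite ler_wpM2r ?expR_ge0// powR_antimono//.
by rewrite subr_le0.
Qed.

Lemma integrable_gamma_integrand (R : realType) (s p : R)
    (D : set (measurableTypeR R)) : s <= 1 -> 0 < p ->
  measurable D -> D `<=` `]p, +oo[%classic ->
  (@lebesgue_measure R).-integrable D (EFin \o gamma_integrand s).
Proof.
move=> s1 p0 mD Dp.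
have := integrableZl mD (p `^ (s - 1)) (integrable_expRN mD Dp).
apply: le_integrable => //.
  apply/measurable_EFinP; exact: measurable_gamma_integrand.
move=> t /Dp; rewrite /= in_itv/= andbT => /ltW pt.
rewrite lee_fin ger0_norm ?gamma_integrand_ge0//.
by rewrite ger0_norm ?gamma_integrand_le// mulr_ge0 ?powR_ge0 ?expR_ge0.
Qed.

(** Only the power is frozen at an end point; the exponential is integrated exactly, so that its
    increments later match those of [thinning]. *)
Lemma gamma_slice_bounds (R : realType) (s p q : R) : s <= 1 -> 0 < p -> p < q ->
  q `^ (s - 1) * (expR (- p) - expR (- q)) <=
  \int[@lebesgue_measure R]_(t in `]p, q]) gamma_integrand s t <=
  p `^ (s - 1) * (expR (- p) - expR (- q)).
Proof.
move=> s1 p0 pq.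
have mpq : measurable (`]p, q]%classic : set (measurableTypeR R)) by exact: measurable_itv.
have sub : `]p, q]%classic `<=` `]p, +oo[%classic.
  by move=> t; rewrite /= !in_itv/= => /andP[->].
have ig := integrable_gamma_integrand s1 p0 mpq sub.
have ie := integrable_expRN mpq sub.
have iE : \int[@lebesgue_measure R]_(t in `]p, q]) expR (- t) = expR (- p) - expR (- q).
  by rewrite /Rintegral integral_expRN.
rewrite -iE -!RintegralZl//; apply/andP; split; apply: le_Rintegral => //.
- exact: (integrableZl mpq _ ie).
- move=> t; rewrite /= in_itv/= => /andP[pt tq].
  by rewrite ler_wpM2r ?expR_ge0// powR_antimono ?subr_le0// (lt_trans p0).
- exact: (integrableZl mpq _ ie).
- move=> t; rewrite /= in_itv/= => /andP[/ltW pt tq]; exact: gamma_integrand_le.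
Qed.

Lemma lower_gamma_slice (R : realType) (s p q : R) : 0 < s -> 0 < p -> p < q ->
  lower_gamma s q =
  lower_gamma s p + \int[@lebesgue_measure R]_(t in `]p, q]) gamma_integrand s t.
Proof.
move=> s0 p0 pq; rewrite /lower_gamma -/(gamma_integrand s).
have E : `]0, q]%classic = `]0, p]%classic `|` `]p, q]%classic :> set R.
  rewrite -itv_bndbnd_setU// bnd_simp; [exact: ltW|exact: ltW].
rewrite E Rintegral_setU//.
- by rewrite -E; apply: integrable_gamma_integrand_0 => //; exact: lt_trans pq.
- apply/disj_setPS => t [] /=; rewrite !in_itv/= => /andP[_ tp] /andP[].
  by rewrite ltNge tp.
Qed.

Lemma upper_gamma_slice (R : realType) (s p q : R) : s <= 1 -> 0 < p -> p < q ->
  upper_gamma s p =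
  \int[@lebesgue_measure R]_(t in `]p, q]) gamma_integrand s t + upper_gamma s q.
Proof.
move=> s1 p0 pq; rewrite /upper_gamma -/(gamma_integrand s).
have E : `]p, +oo[%classic = `]p, q]%classic `|` `]q, +oo[%classic :> set R.
  rewrite -itv_bndbnd_setU// bnd_simp; exact: ltW.
rewrite E Rintegral_setU//.
- rewrite -E; apply: (integrable_gamma_integrand s1 p0) => //.
- apply/disj_setPS => t [] /=; rewrite !in_itv/= andbT => /andP[_ tp].
  by rewrite ltNge tp.
Qed.

Lemma upper_gamma_ge0 (R : realType) (s p : R) : 0 <= upper_gamma s p.
Proof. by apply: Rintegral_ge0 => t _; exact: gamma_integrand_ge0. Qed.

Lemma lower_gamma_ge0 (R : realType) (s p : R) : 0 <= lower_gamma s p.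
Proof. by apply: Rintegral_ge0 => t _; exact: gamma_integrand_ge0. Qed.

(** Used for the slope of [near_primitive] starting at 0, where no slice with a finite right end is
    available. *)
Lemma upper_gamma_le (R : realType) (s p : R) : s <= 1 -> 0 < p ->
  upper_gamma s p <= p `^ (s - 1) * expR (- p).
Proof.
move=> s1 p0.
have mp : measurable (`]p, +oo[%classic : set (measurableTypeR R)) by exact: measurable_itv.
have sub : `]p, +oo[%classic `<=` `]p, +oo[%classic by [].
have ie := integrable_expRN mp sub.
have iE : \int[@lebesgue_measure R]_(t in `]p, +oo[) expR (- t) = expR (- p).
  by rewrite /Rintegral integral_expRN_infty.
rewrite -iE -RintegralZl//; apply: le_Rintegral => //.
- exact: (@integrable_gamma_integrand _ _ _ _ s1 p0 mp sub).
- exact: (integrableZl mp _ ie).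
- by move=> t; rewrite /= in_itv/= andbT => /ltW pt; exact: gamma_integrand_le.
Qed.

Lemma lower_gamma_le (R : realType) (s p : R) : 0 < s -> 0 < p ->
  lower_gamma s p <= p `^ s / s.
Proof.
move=> s0 p0; have := integral_powR_le s0 p0.
have ipow : (@lebesgue_measure R).-integrable `]0, p] (fun t => (t `^ (s - 1))%:E).
  apply/integrableP; split.
    by apply/measurable_EFinP/measurable_funTS; exact: measurable_powR.
  under eq_integral do rewrite gee0_abs ?lee_fin ?powR_ge0//.
  by apply: le_lt_trans (integral_powR_le s0 p0) _; rewrite ltry.
rewrite -[X in (X <= _)%E]fineK ?integrable_fin_num// lee_fin; apply: le_trans.
apply: le_Rintegral => //; first exact: integrable_gamma_integrand_0.
move=> t; rewrite /= in_itv/= => /andP[t0 _].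
by rewrite ler_piMr ?powR_ge0// -expR0 ler_expR oppr_le0 ltW.
Qed.

(** * Closed forms for the integral of 1 - h *)

Section primitives.
Variables (R : realType) (a k : R).
Hypotheses (a_gt0 : 0 < a) (a_lt1 : a < 1) (k_gt0 : 0 < k).

(** For a = alpha / 2 and k = sigma^2 s^2 / 2 this is minus the logarithm of the characteristic
    function of W_j x^(-1/alpha) at s. *)
Definition decay (x : R) : R := k * x `^ (- a^-1).

(* Continuous extension at 0 of x |-> exp (- decay x); note 0 `^ (- a^-1) = 0. *)
Definition thinning (x : R) : R := if x <= 0 then 0 else expR (- decay x).

(** The integral of 1 - h from 0 to x. The case x <= 0 is separate because [decay] is 0 at 0 by the
    convention for powers, so the formula would give k^a Gamma(1 - a) there instead of the limit
    0. *)
Definition near_primitive (x : R) : R :=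
  if x <= 0 then 0
  else x * (1 - expR (- decay x)) + k `^ a * upper_gamma (1 - a) (decay x).

(** Minus the integral of 1 - h from x to infinity, for x > 0. *)
Definition far_primitive (x : R) : R :=
  x * (1 - expR (- decay x)) - k `^ a * lower_gamma (1 - a) (decay x).

Lemma decay_gt0 x : 0 < x -> 0 < decay x.
Proof. by move=> x0; rewrite mulr_gt0// powR_gt0. Qed.

Lemma decay_lt x y : 0 < x -> x < y -> decay y < decay x.
Proof.
move=> x0 xy; have y0 := lt_trans x0 xy.
rewrite ltr_pM2l// 2!powRN ltf_pV2 ?posrE ?powR_gt0//.
by rewrite gt0_ltr_powR ?nnegrE ?invr_gt0 ?ltW.
Qed.

(** The inverse of t = [decay] x is x = k^a t^(-a); the exponent is written as in [gamma_integrand]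
    for 1 - a. *)
Lemma decay_scale x : 0 < x -> k `^ a * decay x `^ (1 - a - 1) = x.
Proof.
move=> x0; rewrite addrAC subrr add0r powRM ?powR_ge0 ?ltW//.
rewrite mulrA -powRD ?subrr ?powRr0 ?mul1r; last by apply/implyP => _; rewrite gt_eqF.
by rewrite -powRrM mulrNN mulVf ?gt_eqF// powRr1// ltW.
Qed.

(** [decay] reverses the order, so the right end [decay x] of the slice contributes the smaller
    factor x. *)
Lemma decay_slice x y : 0 < x -> x < y ->
  x * (expR (- decay y) - expR (- decay x)) <=
  k `^ a * (\int[@lebesgue_measure R]_(t in `]decay y, decay x]) gamma_integrand (1 - a) t) <=
  y * (expR (- decay y) - expR (- decay x)).
Proof.
move=> x0 xy; have y0 := lt_trans x0 xy.
have a1 : 1 - a <= 1 by rewrite gerBl ltW.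
have /andP[h1 h2] := gamma_slice_bounds a1 (decay_gt0 y0) (decay_lt x0 xy).
have := ler_wpM2l (powR_ge0 k a) h1; have := ler_wpM2l (powR_ge0 k a) h2.
by rewrite ![k `^ a * (_ `^ _ * _)]mulrA !decay_scale// => -> ->.
Qed.

Lemma near_primitive_slope x y : 0 <= x -> x <= y ->
  (1 - thinning y) * (y - x) <= near_primitive y - near_primitive x <=
  (1 - thinning x) * (y - x).
Proof.
rewrite le_eqVlt => /predU1P[<-|x0]; rewrite le_eqVlt => /predU1P[<-|xy].
- by rewrite !subrr !mulr0 lexx.
(* From x = 0 the claim reduces to 0 <= k^a Gamma(1 - a, t) <= y e^(-t) with t = [decay a k y]. *)
- rewrite /near_primitive /thinning lexx (leNgt y 0) xy/= !subr0 mul1r.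
  have h0 := upper_gamma_ge0 (1 - a) (decay y).
  have a1 : 1 - a <= 1 by rewrite gerBl ltW.
  have h1 : k `^ a * upper_gamma (1 - a) (decay y) <= y * expR (- decay y).
    have := ler_wpM2l (powR_ge0 k a) (upper_gamma_le a1 (decay_gt0 xy)).
    by rewrite mulrA decay_scale.
  have h2 : 0 <= k `^ a * upper_gamma (1 - a) (decay y) by rewrite mulr_ge0 ?powR_ge0.
  by apply/andP; split; lra.
- by rewrite !subrr !mulr0 lexx.
- have y0 := lt_trans x0 xy.
  have a1 : 1 - a <= 1 by rewrite gerBl ltW.
  rewrite /near_primitive /thinning (leNgt x 0) (leNgt y 0) x0 y0/=.
  (* The increment is y (1 - h y) - x (1 - h x) plus the slice; inserting either slice bound gives
     exactly the corresponding slope bound. *)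
  have /andP[h1 h2] := decay_slice x0 xy.
  rewrite (upper_gamma_slice a1 (decay_gt0 y0) (decay_lt x0 xy)).
  move: h1 h2; set G := \int[_]_(_ in _) _; set U := upper_gamma _ _ => h1 h2.
  by rewrite mulrDr; apply/andP; split; lra.
Qed.

Lemma far_primitive_slope x y : 0 < x -> x <= y ->
  (1 - thinning y) * (y - x) <= far_primitive y - far_primitive x <=
  (1 - thinning x) * (y - x).
Proof.
move=> x0; rewrite le_eqVlt => /predU1P[<-|xy].
  by rewrite !subrr !mulr0 lexx.
have y0 := lt_trans x0 xy.
have a1 : 0 < 1 - a by rewrite subr_gt0.
rewrite /far_primitive /thinning (leNgt x 0) (leNgt y 0) x0 y0/=.
have /andP[h1 h2] := decay_slice x0 xy.
rewrite (lower_gamma_slice a1 (decay_gt0 y0) (decay_lt x0 xy)).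
move: h1 h2; set G := \int[_]_(_ in _) _; set U := lower_gamma _ _ => h1 h2.
by rewrite mulrDr; apply/andP; split; lra.
Qed.

Lemma powR_cvgy (r : R) : 0 < r -> x `^ (- r) @[x --> +oo] --> 0.
Proof.
move=> r0; apply/cvgrPdist_le => e e0.
(* The threshold is the solution of x^(-r) = e. *)
have y0 : 0 < e `^ (- r^-1) by rewrite powR_gt0.
near=> x; rewrite sub0r normrN ger0_norm ?powR_ge0//.
have yx : e `^ (- r^-1) <= x by near: x; exact: nbhs_pinfty_ge.
apply: (le_trans (powR_antimono _ y0 yx)); first by rewrite oppr_le0 ltW.
by rewrite -powRrM mulrNN mulVf ?gt_eqF// powRr1// ltW.
Unshelve. all: by end_near. Qed.

(** Both terms are at most a constant times x [decay] x, that is, of order x^(1 - 1/a), and 1 - 1/a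
    < 0. *)
Lemma far_primitive_cvg : far_primitive x @[x --> +oo] --> 0.
Proof.
have a1 : 0 < 1 - a by rewrite subr_gt0.
have bound x : 0 < x -> `|far_primitive x| <= (1 + (1 - a)^-1) * k * x `^ (- (a^-1 - 1)).
  move=> x0.
  have xE : x * decay x = k * x `^ (- (a^-1 - 1)).
    rewrite /decay mulrCA; congr (_ * _).
    rewrite opprB powRD; last by apply/implyP => _; rewrite gt_eqF.
    by rewrite powRr1 1?ltW.
  rewrite -mulrA -xE (le_trans (ler_normB _ _))// mulrDl mul1r lerD//.
    have e1 : expR (- decay x) <= 1.
      by rewrite -expR0 ler_expR oppr_le0 ltW// decay_gt0.
    rewrite ger0_norm; last by rewrite mulr_ge0 ?subr_ge0// ltW.
    by rewrite ler_pM2l// lerBlDr -lerBlDl expR_ge1Dx.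
  rewrite ger0_norm ?mulr_ge0 ?powR_ge0 ?lower_gamma_ge0//.
  apply: (@le_trans _ _ (k `^ a * (decay x `^ (1 - a) / (1 - a)))).
    by rewrite ler_wpM2l ?powR_ge0// lower_gamma_le// decay_gt0.
  (* Splitting one factor [decay x] off the power leaves k^a t^(-a), which [decay_scale] turns into
     x. *)
  rewrite -(mulr_powRB1 (ltW (decay_gt0 x0)) a1).
  rewrite [X in X <= _](_ : _ = (k `^ a * decay x `^ (1 - a - 1)) *
    (decay x / (1 - a))); last ring.
  by rewrite decay_scale// mulrA mulrC.
apply/norm_cvg0P; apply: (@squeeze_cvgr _ _ _ _ (cst 0)
  (fun x => (1 + (1 - a)^-1) * k * x `^ (- (a^-1 - 1)))).
- near=> x; have x0 : 0 < x by near: x; exact: nbhs_pinfty_gt.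
  by rewrite normr_ge0/= bound.
- exact: cvg_cst.
- rewrite -[X in _ --> X](mulr0 ((1 + (1 - a)^-1) * k)); apply: cvgMr.
  by apply: powR_cvgy; rewrite subr_gt0 invf_gt1.
Unshelve. all: by end_near. Qed.

End primitives.

(** * Products over the arrival times *)

Lemma past_family (T : Type) d' (U : measurableType d') (X : nat -> T -> U)
    (C : set (set T)) (n : nat) D :
  C D -> <<s past X C n >> D.
Proof.
move=> CD; apply: sub_sigma_algebra; exists (fun=> setT) => //; exists D => //.
by apply/seteqP; split => [w Dw|w []//]; split.
Qed.

Lemma measurable_past d (T : measurableType d) d' (U : measurableType d')
    (X : nat -> T -> U) (C : set (set T)) (n i : nat) : C setT -> (i < n)%N ->
  measurable_fun setT (X i : g_sigma_algebraType (past X C n) -> U).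
Proof.
move=> CT ltin _ B mB; rewrite setTI; apply: sub_sigma_algebra.
exists (fun j => if j == i then B else setT); first by move=> j; case: ifP.
exists setT => //; rewrite setTI; apply/seteqP; split => w /=.
  by move=> Bw j /= jn; case: eqP => // ->.
by move=> /(_ i ltin); rewrite /= eqxx.
Qed.

(** Induction on n: the product of the first n factors is measurable for the past, of which the next
    variable is independent. *)
Lemma integral_prod_independent d (T : measurableType d) (R : realType)
    (P : probability T R) d' (U : measurableType d') (X : nat -> {mfun T >-> U})
    (f : nat -> U -> R) (n : nat) :
  mutually_independent P (fun i => X i : T -> U) ->
  (forall i, measurable_fun setT (f i)) -> (forall i u, `|f i u| <= 1) ->
  \int[P]_w (\prod_(i < n) f i (X i w)) = \prod_(i < n) \int[P]_w f i (X i w).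
Proof.
move=> indX mf f1.
have mfX i : measurable_fun setT (fun w => f i (X i w)) by exact: measurableT_comp.
have prod1 m w : `|\prod_(i < m) f i (X i w)| <= 1.
  by rewrite normr_prod; apply: prodr_ile1 => i _; rewrite normr_ge0 f1.
have mprod m : measurable_fun setT (fun w => \prod_(i < m) f i (X i w)).
  by apply: measurable_prod => i _.
elim: n => [|n IHn].
  rewrite big_ord0; under eq_Rintegral do rewrite big_ord0.
  by rewrite Rintegral_cst//= probability_setT mul1r.
rewrite big_ord_recr/= -IHn; under eq_Rintegral do rewrite big_ord_recr/=.
pose Y : {mfun T >-> R} := HB.pack (fun w => \prod_(i < n) f i (X i w))
   (isMeasurableFun.Build _ _ _ _ _ (mprod n)).
pose C : set (set T) := [set setT].
have CT : C setT by [].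
have pastY A : measurable A -> <<s past (fun i => X i : T -> U) C n >> (Y @^-1` A).
  move=> mA; rewrite -[Y @^-1` A]setTI.
  suff : measurable_fun setT (fun w : g_sigma_algebraType (past (fun i => X i : T -> U) C n) =>
      \prod_(i < n) f i (X i w)) by apply.
  apply: measurable_prod => i _; apply: measurableT_comp => //.
  exact: (@measurable_past _ _ _ _ (fun i => X i : T -> U)).
have ind A B : measurable A -> measurable B ->
    P (Y @^-1` A `&` X n @^-1` B) = (P (Y @^-1` A) * P (X n @^-1` B))%E.
  move=> mA mB; apply: (@independent_past _ _ _ P _ _ (fun i => X i : T -> U) C n) => //.
  - by move=> _ ->.
  - by move=> _ _ -> ->; rewrite /C/= setTI.
  - by move=> D _ _ ->; rewrite setIT probability_setT mule1.
  - exact: pastY.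
(* Clamping changes nothing on the values of [Y] but makes [g] bounded on the whole product
   space. *)
pose g (z : R * U) := Num.max (- 1) (Num.min 1 z.1) * f n z.2.
have clamp (x : R) : `|x| <= 1 -> Num.max (- 1) (Num.min 1 x) = x.
  by rewrite ler_norml => /andP[h1 h2]; rewrite (min_idPr h2) (max_idPr h1).
have := @integral_independent_pair _ _ _ P _ _ _ _ Y (X n) g 1 ind.
have -> : \int[P]_w (\prod_(i < n) f i (X i w) * f n (X n w)) =
  fine (\int[P]_w (g (Y w, X n w))%:E)%E.
  by apply: eq_Rintegral => w _; rewrite /g/= clamp ?prod1.
move=> ->.
- transitivity (\int[P]_w (\prod_(i < n) f i (X i w) * \int[P]_w f n (X n w))).
    apply: congr1; apply: eq_integral => w _.
    under eq_integral do rewrite /g/= clamp ?prod1// EFinM.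
    rewrite integralZl//; last first.
      exact: (@integrable_bounded _ _ _ (distribution P (X n)) _ 1).
    rewrite EFinM; congr (_ * _)%E.
    rewrite (@integral_distribution _ _ _ _ _ P (X n) (EFin \o f n))//.
    + rewrite /Rintegral fineK//.
      apply: integrable_fin_num => //.
      exact: (@integrable_bounded _ _ _ P _ 1).
    + exact/measurable_EFinP.
    + exact: (@integrable_bounded _ _ _ P _ 1).
  by rewrite RintegralZr//; exact: (@integrable_bounded _ _ _ P _ 1).
- apply: measurable_funM; last exact: measurableT_comp.
  apply: measurable_maxr => //; apply: measurable_minr => //.
- move=> [x u]; rewrite /g/= normrM mulr_ile1//.
  by rewrite ler_norml le_max lexx/= ge_max ge_min lexx/= andbT; lra.
Qed.

(** The Poisson generating function: split the space by the value of [X] and sum the exponential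
    series. *)
Lemma integral_poisson_exp d (T : measurableType d) (R : realType)
    (P : probability T R) (X : {mfun T >-> nat}) (lam y : R) : 0 < lam -> 0 <= y ->
  (forall k, P [set w | X w = k] = (poisson_pmf lam k)%:E) ->
  \int[P]_w (y ^+ X w) = expR (- ((1 - y) * lam)).
Proof.
move=> lam0 y0 XP.
have mk k : measurable [set w | X w = k].
  rewrite -[Y in measurable Y]setTI.
  exact: (@measurable_funPT _ _ _ _ X measurableT [set k]).
have UX : \bigcup_k [set w | X w = k] = setT.
  by apply/seteqP; split => // w _; exists (X w).
rewrite /Rintegral -UX ge0_integral_bigcup//=; last 3 first.
- rewrite UX; apply/measurable_EFinP.
  exact: (measurableT_comp (f := fun k : nat => y ^+ k)).
- by move=> w _; rewrite lee_fin exprn_ge0.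
- by move=> i j _ _ [w [/= <- <-]].
have -> : (\big[+%E/0]_(0 <= k <oo) \int[P]_(w in [set w | X w = k]) (y ^+ X w)%:E)%E =
   (\big[+%E/0]_(0 <= k <oo) (expR (- lam) * exp_coeff (y * lam) k)%:E)%E.
  apply: eq_eseriesr => k _.
  rewrite (eq_integral (cst (y ^+ k)%:E)); last by move=> w; rewrite inE/= => ->.
  rewrite integral_cst//= XP -EFinM /poisson_pmf lam0 /exp_coeff/=.
  by congr EFin; rewrite exprMn; ring.
have h : (\sum_(0 <= k < n) (expR (- lam) * exp_coeff (y * lam) k)%:E)%E @[n --> \oo] -->
   (expR (- lam) * expR (y * lam))%:E.
  under eq_fun do rewrite sumEFin -mulr_sumr.
  apply: cvg_EFin; first exact: nearW.
  by apply: cvgMr; exact: is_cvg_series_exp_coeff.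
rewrite (cvg_lim _ h)//= -expRD; congr expR; ring.
Qed.

(* When the path never exceeds j, [inf set0 = 0] makes both sides false. *)
Lemma arrival_in_itv (R : realType) (N : R -> nat) (j : nat) (x y : R) :
  (forall s t, 0 <= s -> s <= t -> (N s <= N t)%N) ->
  (forall t : R, 0 <= t -> \forall u \near t^'+, N u = N t) ->
  0 <= x -> x <= y ->
  (x < inf [set t : R | 0 <= t /\ (j < N t)%N] <= y) = (N x <= j < N y)%N.
Proof.
move=> ndN rcN x0 xy.
set A := [set t | _].
have le_inf z : 0 <= z -> A !=set0 -> (inf A <= z) = (j < N z)%N.
  move=> z0 A0; apply/idP/idP => [Az|jz]; last first.
    by apply: ge_inf; [exists 0 => t []|split].
  (* [N] is constant on a short interval to the right of z, and an infimum at most z forces a point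
     of [A] before the end of that interval. *)
  have [e /= e0 zeP] := rcN _ z0.
  have [t [t0 jt] tze] := inf_lt A0 (le_lt_trans Az (ltr_pwDr e0 (lexx z))).
  have [tz|zt] := leP t z; first exact: leq_trans jt (ndN _ _ t0 tz).
  rewrite -(zeP t)//= ltr_norml; apply/andP; split; lra.
have y0 := le_trans x0 xy.
have [A0|] := pselect (A !=set0); first by rewrite ltNge !le_inf// -leqNgt.
move=> /nonemptyPn A0; rewrite A0 inf0 ltNge x0/=.
apply/esym/negbTE; rewrite negb_and -!leqNgt; apply/orP; right.
rewrite leqNgt; apply/negP => jy.
by have : A y by []; rewrite A0.
Qed.

(** The bounds [a] and [b] will be random counts and [M] a fixed truncation; the factors 1 make the
    number of factors deterministic. *)
Lemma prod_window (R : comNzRingType) (F : nat -> R) (a b M : nat) :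
  (a <= b)%N -> (b <= M)%N ->
  \prod_(j < M) (if (a <= j < b)%N then F j else 1) = \prod_(a <= j < b) F j.
Proof.
move=> ab bM.
rewrite -(big_mkord xpredT (fun j => if (a <= j < b)%N then F j else 1)).
by rewrite -big_mkcond/= [RHS](big_nat_widenl _ 0)// [RHS](big_nat_widen 0 b M).
Qed.

(** Truncation at n only drops factors at most 1. This is why the lower bound of
    [thinned_product_bounds] has no tail term. *)
Lemma le_prod_window (R : numDomainType) (F : nat -> R) (a b n : nat) :
  (forall j, 0 <= F j <= 1) -> (a <= b)%N ->
  \prod_(a <= j < b) F j <= \prod_(j < n) (if (a <= j < b)%N then F j else 1).
Proof.
move=> F01 ab.
pose G j := if (a <= j < b)%N then F j else 1.
have G01 j : 0 <= G j <= 1 by rewrite /G; case: ifP; rewrite ?lexx ?ler01.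
rewrite -(prod_window F ab (leq_maxl b n)) -/(G _).
rewrite -(big_mkord xpredT G) -(big_mkord xpredT G) (@big_cat_nat _ _ _ n)//= ?leq_maxr//.
rewrite ler_piMr//; first by apply: prodr_ge0 => j _; case/andP: (G01 j).
by apply: prodr_ile1.
Qed.

(** A statement about a single path: the indices counted between t_i and t_(i+1) belong to arrivals
    in ]t_i, t_(i+1)], where [th] lies between its end values. *)
Lemma prod_arrivals_bounds (R : realType) (N : R -> nat) (g : nat -> R)
    (th : R -> R) (t : nat -> R) (m : nat) :
  (forall x y j, 0 <= x -> x <= y -> (x < g j <= y) = (N x <= j < N y)%N) ->
  (forall x y, 0 <= x -> x <= y -> (N x <= N y)%N) ->
  0 <= t 0 -> {homo t : i j / (i <= j)%N >-> i <= j} ->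
  (forall x, 0 <= th x) -> (forall x y, 0 <= x -> x <= y -> th x <= th y) ->
  \prod_(i < m) th (t i) ^+ (N (t i.+1) - N (t i)) <=
  \prod_(N (t 0) <= j < N (t m)) th (g j) <=
  \prod_(i < m) th (t i.+1) ^+ (N (t i.+1) - N (t i)).
Proof.
move=> gE ndN t0 tnd th0 thnd.
elim: m => [|m /andP[IH1 IH2]]; first by rewrite !big_ord0 big_geq// lexx.
have tm : 0 <= t m by rewrite (le_trans t0)// tnd.
have tmm : t m <= t m.+1 by apply: tnd.
rewrite !big_ord_recr/= (@big_cat_nat _ _ _ (N (t m)))//=; last 2 first.
- by apply: ndN => //; exact: tnd.
- exact: ndN.
have slice : th (t m) ^+ (N (t m.+1) - N (t m)) <=
    \prod_(N (t m) <= j < N (t m.+1)) th (g j) <=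
    th (t m.+1) ^+ (N (t m.+1) - N (t m)).
  rewrite -!prodr_const_nat; apply/andP; split; rewrite !big_nat;
    apply: ler_prod => j; rewrite -(gE _ _ j tm tmm) => /andP[/ltW h1 h2];
    by rewrite th0/= thnd// (le_trans tm).
case/andP: slice => s1 s2.
by apply/andP; split; apply: ler_pM => //; rewrite ?exprn_ge0// prodr_ge0// => i _;
  rewrite exprn_ge0.
Qed.

Lemma increments_expectation d (T : measurableType d) (R : realType)
    (P : probability T R) (N : R -> {RV P >-> nat}) (t y : nat -> R) (m : nat) :
  poisson_process 1 N -> 0 <= t 0 -> (forall i, t i < t i.+1) ->
  (forall i, 0 <= y i <= 1) ->
  \int[P]_w (\prod_(i < m) y i ^+ (N (t i.+1) w - N (t i) w)) =
  expR (- (\sum_(i < m) (1 - y i) * (t i.+1 - t i))).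
Proof.
move=> hN t0 tinc y01.
have tnd : {homo t : i j / (i <= j)%N >-> i <= j}.
  by apply/nondecreasing_seqP => i; exact: ltW.
have mX i : measurable_fun setT (fun w => (N (t i.+1) w - N (t i) w)%N).
  by apply: measurable_fun_subn; exact: measurable_funPT.
pose X i : {mfun T >-> nat} := HB.pack (fun w => (N (t i.+1) w - N (t i) w)%N)
   (isMeasurableFun.Build _ _ _ _ _ (mX i)).
transitivity (\int[P]_w (\prod_(i < m) y i ^+ X i w)) => //.
rewrite (@integral_prod_independent _ _ _ P _ _ X (fun i k => y i ^+ k))//.
- rewrite raddf_sum/= expR_sum; apply: eq_bigr => i _.
  have ti : 0 <= t i by rewrite (le_trans t0)// tnd.
  rewrite (@integral_poisson_exp _ _ _ P (X i) (t i.+1 - t i)) ?subr_gt0//.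
    by case/andP: (y01 i).
  by move=> k; rewrite [LHS](poisson_process_increments hN ti (tinc i)) mul1r.
- exact: (poisson_process_independent_increments hN).
- move=> i k; case/andP: (y01 i) => yi0 yi1.
  by rewrite ger0_norm ?exprn_ge0// exprn_ile1.
Qed.

Lemma measurable_tail d (T : measurableType d) (X : {mfun T >-> nat}) (n : nat) :
  measurable [set w | (n < X w)%N].
Proof.
rewrite -[X in measurable X]setTI.
exact: (@measurable_funPT _ _ _ _ X measurableT [set k | (n < k)%N]).
Qed.

Lemma ae_le_Rintegral d (T : measurableType d) (R : realType)
    (P : probability T R) (f g : T -> R) (M : R) :
  measurable_fun setT f -> measurable_fun setT g ->
  (forall w, 0 <= f w <= M) -> (forall w, 0 <= g w <= M) ->
  {ae P, forall w, f w <= g w} ->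
  \int[P]_w f w <= \int[P]_w g w.
Proof.
move=> mf mg f01 g01 fg.
have nf w : `|f w| <= M by have /andP[h1 h2] := f01 w; rewrite ger0_norm.
have ng w : `|g w| <= M by have /andP[h1 h2] := g01 w; rewrite ger0_norm.
apply: fine_le.
- exact: (integrable_fin_num _ (integrable_bounded P mf nf)).
- exact: (integrable_fin_num _ (integrable_bounded P mg ng)).
apply: ae_ge0_le_integral => //.
- by move=> w _; case/andP: (f01 w).
- exact/measurable_EFinP.
- by move=> w _; case/andP: (g01 w).
- exact/measurable_EFinP.
- by apply: filterS fg => w fgw _; rewrite lee_fin.
Qed.

Lemma Rintegral_probability_indic d (T : measurableType d) (R : realType)
    (P : probability T R) (A : set T) :
  measurable A -> \int[P]_w \1_A w = fine (P A).
Proof. by move=> mA; rewrite /Rintegral integral_indic// setIT. Qed.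

(** Gathers the path properties outside one null set that serves all times and indices
    simultaneously. *)
Lemma arrivals_counted d (T : measurableType d) (R : realType)
    (P : probability T R) (N : R -> {RV P >-> nat}) (G : nat -> {RV P >-> R}) :
  poisson_process 1 N -> arrival_times N G ->
  {ae P, forall w, (forall x y, 0 <= x -> x <= y -> (N x w <= N y w)%N) /\
    (forall x y j, 0 <= x -> x <= y -> (x < G j w <= y) = (N x w <= j < N y w)%N)}.
Proof.
move=> hN; have := poisson_process_nondecreasing hN.
have := poisson_process_right_continuous hN.
apply: filterS3 => w rcw ndw Gw; split => // x y j x0 xy.
by rewrite Gw (@arrival_in_itv _ (fun t => N t w)).
Qed.

(** The gap between q' and q leaves the right end of the window undecided: on ]q', q] only [th] <=
    [psi] <= 1 is known. The tail probability pays for paths on which arrivals of ]p, q'] have index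
    n or more. *)
Lemma thinned_product_bounds d (T : measurableType d) (R : realType)
    (P : probability T R) (N : R -> {RV P >-> nat}) (G : nat -> {RV P >-> R})
    (th K psi : R -> R) (p q' q : R) (n : nat) :
  poisson_process 1 N -> arrival_times N G ->
  0 <= p -> p < q' -> q' <= q ->
  (forall x, 0 <= th x <= 1) -> (forall x y, 0 <= x -> x <= y -> th x <= th y) ->
  (forall x y, p <= x -> x <= y ->
    (1 - th y) * (y - x) <= K y - K x <= (1 - th x) * (y - x)) ->
  measurable_fun setT psi -> (forall x, 0 <= psi x <= 1) ->
  (forall x, p < x <= q' -> psi x = th x) ->
  (forall x, p < x <= q -> th x <= psi x) ->
  (forall x, ~~ (p < x <= q) -> psi x = 1) ->
  expR (- (K q - K p)) <= \int[P]_w (\prod_(j < n) psi (G j w)) <=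
  expR (- (K q' - K p)) + fine (P [set w | (n < N q' w)%N]).
Proof.
move=> hN hG p0 pq' q'q th01 thnd slope mpsi psi01 psi_eq psi_ge psi_out.
have pq := lt_le_trans pq' q'q.
have q'0 : 0 <= q' by rewrite (le_trans p0)// ltW.
have q0 : 0 <= q by rewrite (le_trans p0)// ltW.
have good := arrivals_counted hN hG.
have Bn_mes : measurable_fun setT (fun w => \prod_(j < n) psi (G j w)).
  by apply: measurable_prod => j _; exact: measurableT_comp.
have Bn01 w : 0 <= \prod_(j < n) psi (G j w) <= 1.
  rewrite prodr_ge0/=; last by move=> j _; case/andP: (psi01 (G j w)).
  exact: prodr_ile1.
have step_mes (t y : nat -> R) m :
    measurable_fun setT (fun w => \prod_(i < m) y i ^+ (N (t i.+1) w - N (t i) w)).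
  apply: measurable_prod => i _.
  apply: (measurableT_comp (f := fun k : nat => y i ^+ k)) => //.
  by apply: measurable_fun_subn; exact: measurable_funPT.
have step01 (t : nat -> R) (y : nat -> R) m w : (forall i, 0 <= y i <= 1) ->
    0 <= \prod_(i < m) y i ^+ (N (t i.+1) w - N (t i) w) <= 1.
  move=> y01; rewrite prodr_ge0/=; last first.
    by move=> i _; rewrite exprn_ge0//; case/andP: (y01 i).
  by apply: prodr_ile1 => i _; case/andP: (y01 i) => h1 h2; rewrite exprn_ge0//= exprn_ile1.
have delta_cvg (a b r : R) : expR (r + a * (b / m.+1%:R)) @[m --> \oo] --> expR r.
  apply: continuous_cvg; first exact: continuous_expR.
  rewrite -[X in _ --> X]addr0; apply: cvgD; first exact: cvg_cst.
  rewrite -[X in _ --> X](mulr0 a); apply: cvgMr.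
  by rewrite -[X in _ --> X](mulr0 b); apply: cvgMr; exact: cvg_harmonic.
(* Uniform partition of [p, r] into m + 1 intervals, used with r = q for the lower and r = q' for
   the upper bound. *)
pose t (r : R) (m i : nat) := p + i%:R * ((r - p) / m.+1%:R).
have tS r m i : t r m i.+1 - t r m i = (r - p) / m.+1%:R by rewrite /t -natr1; ring.
have t0 r m : t r m 0 = p by rewrite /t mul0r addr0.
have tm r m : t r m m.+1 = r by rewrite /t mulrC divfK ?pnatr_eq0// subrKC.
have tinc r m i : p < r -> t r m i < t r m i.+1.
  by move=> pr; rewrite -subr_gt0 tS divr_gt0 ?subr_gt0.
have tnd r m : p < r -> {homo t r m : i j / (i <= j)%N >-> i <= j}.
  by move=> pr; apply/nondecreasing_seqP => i; exact/ltW/tinc.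
have tge r m i : p < r -> p <= t r m i by move=> pr; rewrite -{1}(t0 r m) tnd.
have Ktel r m : \sum_(i < m.+1) (K (t r m i.+1) - K (t r m i)) = K r - K p.
  rewrite -(big_mkord xpredT (fun i => K (t r m i.+1) - K (t r m i))).
  by rewrite telescope_sumr// tm t0.
have thtel r m : \sum_(i < m.+1) (th (t r m i.+1) - th (t r m i)) = th r - th p.
  rewrite -(big_mkord xpredT (fun i => th (t r m i.+1) - th (t r m i))).
  by rewrite telescope_sumr// tm t0.
(* The left and right Riemann sums differ by a telescoping sum times the mesh, and [th] varies by at
   most 1. *)
have riemann_gap r m : p < r ->
    \sum_(i < m.+1) (1 - th (t r m i)) * (t r m i.+1 - t r m i) -
    \sum_(i < m.+1) (1 - th (t r m i.+1)) * (t r m i.+1 - t r m i) <= (r - p) / m.+1%:R.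
  move=> pr; rewrite -sumrB.
  rewrite (eq_bigr (fun i : 'I_m.+1 => (th (t r m i.+1) - th (t r m i)) *
    ((r - p) / m.+1%:R))); last by move=> i _; rewrite tS; ring.
  rewrite -mulr_suml thtel ler_piMl//; first by rewrite divr_ge0 ?subr_ge0 ?ltW.
  by have /andP[r0 r1] := th01 r; have /andP[p0' p1] := th01 p; lra.
apply/andP; split.
- apply: (cvgr_to_le (delta_cvg (- 1) (q - p) (- (K q - K p)))).
  apply: nearW => m.
  apply: (@le_trans _ _ (\int[P]_w (\prod_(i < m.+1)
     th (t q m i) ^+ (N (t q m i.+1) w - N (t q m i) w)))).
    rewrite (@increments_expectation _ _ _ P N (t q m) (fun i => th (t q m i)))//; last 2 first.
    + by rewrite t0.
    + by move=> i; exact: tinc.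
    rewrite ler_expR mulN1r -opprD lerN2 -lerBlDl.
    (* The left sum exceeds the right sum by at most the mesh, and the right sum is at most the
       increment of [K]. *)
    apply: le_trans (riemann_gap _ m pq). rewrite lerD2l lerN2 -(Ktel q m).
    apply: ler_sum => i _.
    by case/andP: (slope (t q m i) (t q m i.+1) (tge _ _ _ pq) (ltW (tinc _ _ _ pq))).
  apply: (@ae_le_Rintegral _ _ _ P _ _ 1) => //.
  - exact: (step_mes (t q m) (fun i => th (t q m i))).
  - by move=> w; exact: (step01 (t q m) (fun i => th (t q m i)) m.+1 w (fun i => th01 _)).
  apply: filterS good => w [ndw Gw].
  have := @prod_arrivals_bounds _ (fun x => N x w) (fun j => G j w) th (t q m) m.+1 Gw ndw.
  rewrite t0 tm => /(_ p0 (tnd _ _ pq) (fun x => (andP (th01 x)).1) thnd) /andP[h _].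
  apply: (le_trans h); apply: (le_trans (@le_prod_window _ _ _ _ n _ _)).
  + by move=> j; exact: th01.
  + by apply: ndw => //; exact: ltW.
  + apply: ler_prod => j _; rewrite -(Gw _ _ j p0 (ltW pq)).
    case: ifPn => [Gj|/psi_out -> //]; last by rewrite ler01 lexx.
    by rewrite psi_ge// andbT; case/andP: (th01 (G j w)).
- rewrite -lerBlDr.
  apply: (cvgr_to_ge (delta_cvg 1 (q' - p) (- (K q' - K p)))).
  apply: nearW => m.
  have mtail := measurable_tail (N q') n.
  rewrite lerBlDr -(Rintegral_probability_indic P mtail).
  apply: (@le_trans _ _ (\int[P]_w (\prod_(i < m.+1)
     th (t q' m i.+1) ^+ (N (t q' m i.+1) w - N (t q' m i) w)
      + \1_[set w | (n < N q' w)%N] w))).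
    (* The bound 2 is 1 for the product plus 1 for the indicator. *)
    apply: (@ae_le_Rintegral _ _ _ P _ _ 2) => //.
    + by apply: measurable_funD => //; exact: (step_mes (t q' m) (fun i => th (t q' m i.+1))).
    + by move=> w; case/andP: (Bn01 w) => -> h /=; lra.
    + move=> w; have /andP[h1 h2] :=
        step01 (t q' m) (fun i => th (t q' m i.+1)) m.+1 w (fun i => th01 _).
      rewrite indicE; case: (_ \in _) => /=; apply/andP; split; lra.
    apply: filterS good => w [ndw Gw].
    (* With more than n arrivals the indicator alone dominates; otherwise the whole window ]p, q']
       is covered by the first n indices. *)
    have [nN|Nn] := ltnP n (N q' w).
      rewrite indicE mem_set//=.
      have /andP[h1 h2] :=
        step01 (t q' m) (fun i => th (t q' m i.+1)) m.+1 w (fun i => th01 _).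
      by have /andP[] := Bn01 w; lra.
    rewrite indicE memNset ?addr0/=; last by rewrite /= ltnNge Nn.
    have := @prod_arrivals_bounds _ (fun x => N x w) (fun j => G j w) th (t q' m) m.+1 Gw ndw.
    rewrite t0 tm => /(_ p0 (tnd _ _ pq') (fun x => (andP (th01 x)).1) thnd) /andP[_ h].
    apply: le_trans h; rewrite -(prod_window (fun j => th (G j w)) _ Nn); last first.
      by apply: ndw => //; exact: ltW.
    apply: ler_prod => j _; rewrite -(Gw _ _ j p0 (ltW pq')).
    case/andP: (psi01 (G j w)) => -> psi1 /=.
    by case: ifPn => // Gj; rewrite psi_eq.
  rewrite RintegralD//; last 2 first.
  + apply: (@integrable_bounded _ _ _ P _ 1).
      exact: (step_mes (t q' m) (fun i => th (t q' m i.+1))).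
    move=> w; have /andP[h1 h2] :=
      step01 (t q' m) (fun i => th (t q' m i.+1)) m.+1 w (fun i => th01 _).
    by rewrite ger0_norm.
  + exact: integrable_indic.
  rewrite lerD2r.
  rewrite (@increments_expectation _ _ _ P N (t q' m) (fun i => th (t q' m i.+1)))//; last 2 first.
  + by rewrite t0.
  + by move=> i; exact: tinc.
  rewrite ler_expR mul1r.
  have gap := riemann_gap _ m pq'.
  have : K q' - K p <= \sum_(i < m.+1) (1 - th (t q' m i)) * (t q' m i.+1 - t q' m i).
    rewrite -(Ktel q' m); apply: ler_sum => i _.
    by case/andP: (slope (t q' m i) (t q' m i.+1) (tge _ _ _ pq') (ltW (tinc _ _ _ pq'))).
  move: gap; set S1 := \sum_(i < _) (1 - th (t _ _ i)) * _; set S2 := \sum_(i < _) _.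
  move=> gap h; apply: (@le_trans _ _ (- S1 + (q' - p) / m.+1%:R)).
    by rewrite addrC lerBrDr addrC.
  by rewrite lerD2r lerN2.
Qed.

(** * Shot noise *)

Lemma generated_sigma_algebra_measurable d (T : measurableType d) d'
    (U : measurableType d') (I : Type) (X : I -> T -> U) :
  (forall i, measurable_fun setT (X i)) ->
  generated_sigma_algebra X `<=` measurable.
Proof.
move=> mX; apply: smallest_sub; first exact: sigma_algebra_measurable.
by move=> _ [i _ [B mB <-]]; exact: mX.
Qed.

(** [W n] is independent of all arrival times and the earlier W_j, so everything else is frozen: [h]
    is the coefficient of [W n], [Y] the phase with the remaining sum, and [b] the Gaussian factors
    already extracted. *)
Lemma gaussian_peeling_step d (T : measurableType d) (R : realType)
    (P : probability T R) (G W : nat -> {RV P >-> R}) (sigma : R)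
    (Y h b : T -> R) (n : nat) :
  sigma != 0 -> iid_centered_normal sigma W ->
  independent_families P (fun j => W j : T -> R) (fun j => G j : T -> R) ->
  (let F := g_sigma_algebraType (past (fun j => W j : T -> R)
      (generated_sigma_algebra (fun j => G j : T -> R)) n) in
   [/\ measurable_fun setT (Y : F -> R), measurable_fun setT (h : F -> R) &
       measurable_fun setT (b : F -> R)]) ->
  (forall w, 0 <= b w <= 1) ->
  \int[P]_w (b w * cos (h w * W n w + Y w)) =
  \int[P]_w (b w * (cos (Y w) * expR (- (sigma ^+ 2 * h w ^+ 2 / 2)))).
Proof.
move=> s0 [indW lawW] indWG [mY mh mb] b01.
set C := generated_sigma_algebra _ in mY mh mb *.
set W' := fun j => W j : T -> R in mY mh mb *.
have mW i : measurable_fun setT (W' i) by exact: measurable_funPT.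
have Cm : C `<=` measurable.
  by apply: generated_sigma_algebra_measurable => i; exact: measurable_funPT.
have CT : C setT by exact: (@measurableT _ (g_sigma_algebraType _)).
have indpast := @independent_past _ _ _ P _ _ W' C n mW indW Cm
  (@measurableI _ (g_sigma_algebraType _)) CT indWG.
have sub : <<s past W' C n >> `<=` measurable.
  apply: smallest_sub; first exact: sigma_algebra_measurable.
  move=> _ [A mA [D /Cm mD ->]]; apply: measurableI => //.
  apply: bigcap_measurableType => i _.
  by rewrite -[X in measurable X]setTI; exact: mW.
have mYhb : measurable_fun setT
    (fun w : g_sigma_algebraType (past W' C n) => (Y w, (h w, b w))).
  by apply/measurable_fun_pairP; split => //; apply/measurable_fun_pairP; split.
have mYhb' : measurable_fun setT (fun w => (Y w, (h w, b w))).
  by move=> _ A mA; apply: sub; exact: mYhb.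
pose Z : {mfun T >-> (R * (R * R))%type} := HB.pack (fun w => (Y w, (h w, b w)))
   (isMeasurableFun.Build _ _ _ _ _ mYhb').
have mWn : measurable_fun setT (W n : T -> measurableTypeR R) := mW n.
(* The law of W n lives on R, normal_prob on measurableTypeR R: same sets, other display. *)
pose V : {mfun T >-> measurableTypeR R} := HB.pack (W n : T -> measurableTypeR R)
   (isMeasurableFun.Build _ _ _ _ _ mWn).
have ind A B : measurable A -> measurable B ->
    P (Z @^-1` A `&` V @^-1` B) = (P (Z @^-1` A) * P (V @^-1` B))%E.
  move=> mA mB; apply: indpast => //.
  by rewrite -[X in <<s _ >> X]setTI; exact: mYhb.
(* Clamping makes the integrand bounded on the whole product space. *)
pose f (z : (R * (R * R)) * measurableTypeR R) : R :=
  Num.max 0 (Num.min 1 z.1.2.2) * cos (z.1.2.1 * z.2 + z.1.1).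
have clamp (x : R) : 0 <= x <= 1 -> Num.max 0 (Num.min 1 x) = x.
  by move=> /andP[h1 h2]; rewrite (min_idPr h2) (max_idPr h1).
have mcos : measurable_fun setT (@cos R).
  by apply: continuous_measurable_fun; exact: continuous_cos.
have mfst : measurable_fun setT (fun z : (R * (R * R)) * measurableTypeR R => z.1.2).
  exact: (measurableT_comp measurable_snd measurable_fst).
have mf : measurable_fun setT f.
  apply: measurable_funM.
    apply: measurable_maxr => //; apply: measurable_minr => //.
    exact: (measurableT_comp measurable_snd mfst).
  apply: (measurableT_comp (f := cos)) => //.
  apply: measurable_funD.
    apply: measurable_funM; last exact: (@measurable_snd _ _ _ (measurableTypeR R)).
    exact: (measurableT_comp measurable_fst mfst).
  exact: (measurableT_comp measurable_fst measurable_fst).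
have f1 z : `|f z| <= 1.
  rewrite normrM mulr_ile1 ?cos_max// ler_norml ge_max ge_min lexx/=.
  by rewrite le_max ler01 andbT; apply/orP; left; lra.
have := integral_independent_pair ind mf f1.
have -> : \int[P]_w (b w * cos (h w * W n w + Y w)) =
  fine (\int[P]_w (f (Z w, V w))%:E)%E.
  by apply: eq_Rintegral => w _; rewrite /f/= clamp.
move=> ->; congr fine; apply: eq_integral => w _.
transitivity (\int[normal_prob 0 sigma]_v (f (Z w, v))%:E)%E.
  by apply: eq_measure_integral => A mA _; exact: lawW.
under eq_integral do rewrite /f/= clamp// EFinM.
rewrite integralZl//.
  by rewrite normal_prob_cos// -EFinM.
exact: (integrable_bounded (normal_prob 0 sigma) (measurable_cos_affine _ _)
  (fun x => cos_max _)).
Qed.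

Lemma gaussian_peeling d (T : measurableType d) (R : realType)
    (P : probability T R) (G W : nat -> {RV P >-> R}) (sigma th s : R)
    (g : R -> R) (n : nat) :
  sigma != 0 -> iid_centered_normal sigma W ->
  independent_families P (fun j => W j : T -> R) (fun j => G j : T -> R) ->
  measurable_fun setT g ->
  \int[P]_w cos (s * (\sum_(j < n) W j w * g (G j w)) + th) =
  cos th * \int[P]_w \prod_(j < n) expR (- (sigma ^+ 2 * (s * g (G j w)) ^+ 2 / 2)).
Proof.
move=> s0 hW hWG mg.
pose psi x := expR (- (sigma ^+ 2 * (s * g x) ^+ 2 / 2)).
have mpsi : measurable_fun setT psi.
  apply: measurableT_comp => //; apply: measurableT_comp => //.
  apply: measurable_funM => //; apply: measurable_funM => //.
  by apply: measurable_funX; exact: measurable_funM.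
have psi01 x : 0 <= psi x <= 1.
  rewrite expR_ge0 -expR0 ler_expR oppr_le0 mulr_ge0// mulr_ge0 ?sqr_ge0//.
pose C := generated_sigma_algebra (fun j => G j : T -> R).
have mGC j : measurable_fun setT (G j : g_sigma_algebraType C -> R).
  move=> _ B mB; rewrite setTI; apply: sub_sigma_algebra.
  apply: sub_sigma_algebra; exists j => //; exists B => //.
  by rewrite setTI.
have CE : <<s C >> = C by apply: sigma_algebra_id; exact: smallest_sigma_algebra.
have CT : C setT by rewrite -CE; exact: (@measurableT _ (g_sigma_algebraType C)).
pose Fn m := g_sigma_algebraType (past (fun j => W j : T -> R) C m).
have lift (f : T -> R) m : measurable_fun setT (f : g_sigma_algebraType C -> R) ->
    measurable_fun setT (f : Fn m -> R).
  move=> mf _ B mB; rewrite setTI; apply: past_family; rewrite -CE.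
  by rewrite -[X in <<s _ >> X]setTI; exact: mf.
(* The induction needs a weight [b] depending on the arrival times alone, which absorbs the factor
   produced by each peeled W_j. *)
suff gen m (b : T -> R) : measurable_fun setT (b : g_sigma_algebraType C -> R) ->
    (forall w, 0 <= b w <= 1) ->
    \int[P]_w (b w * cos (s * (\sum_(j < m) W j w * g (G j w)) + th)) =
    \int[P]_w (b w * (cos th * \prod_(j < m) psi (G j w))).
  have h : \int[P]_w cos (s * (\sum_(j < n) W j w * g (G j w)) + th) =
      \int[P]_w (cos th * \prod_(j < n) psi (G j w)).
    have b01 (w : T) : 0 <= (cst 1 w : R) <= 1 by rewrite ler01 lexx.
    have := gen n (cst 1) (measurable_cst _) b01.
    under eq_Rintegral do rewrite mul1r.
    by under [in X in _ = X -> _]eq_Rintegral do rewrite mul1r.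
  rewrite h RintegralZl//; apply: (@integrable_bounded _ _ _ P _ 1).
    apply: measurable_prod => j _.
    by apply: (measurableT_comp (f := psi)) => //; exact: measurable_funPT.
  move=> w; rewrite normr_prod; apply: prodr_ile1 => j _; rewrite normr_ge0/=.
  by have /andP[p0 p1] := psi01 (G j w); rewrite ger0_norm.
elim: m b => [|m IHm] b mb b01.
  by apply: eq_Rintegral => w _; rewrite !big_ord0 mulr0 add0r mulr1.
transitivity (\int[P]_w ((b w * psi (G m w)) *
    cos (s * (\sum_(j < m) W j w * g (G j w)) + th))); last first.
  rewrite IHm.
  - by apply: eq_Rintegral => w _; rewrite big_ord_recr/=; ring.
  - apply: measurable_funM => //.
    apply: (measurableT_comp (f := psi)) => //; exact: mGC.
  - move=> w; have /andP[b0 b1] := b01 w; have /andP[p0 p1] := psi01 (G m w).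
    by rewrite mulr_ge0//= mulr_ile1.
transitivity (\int[P]_w (b w * cos ((s * g (G m w)) * W m w +
    (s * (\sum_(j < m) W j w * g (G j w)) + th)))).
  apply: eq_Rintegral => w _; rewrite big_ord_recr/=.
  by congr (_ * cos _); ring.
rewrite (@gaussian_peeling_step _ _ _ P G W sigma
  (fun w => s * (\sum_(j < m) W j w * g (G j w)) + th)
  (fun w => s * g (G m w)) b m)//.
  by apply: eq_Rintegral => w _; rewrite -/(psi _); ring.
have mgG j : measurable_fun setT (fun w : Fn m => g (G j w)).
  by apply: (lift (fun w => g (G j w))); apply: measurableT_comp => //; exact: mGC.
split.
- apply: measurable_funD => //; apply: measurable_funM => //.
  apply: measurable_sum => j; apply: measurable_funM; last exact: mgG.
  exact: (@measurable_past _ _ _ _ (fun j => W j : T -> R)).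
- exact: measurable_funM.
- exact: lift.
Qed.

(** With membership as a factor, the sum over a random index set becomes a sum of W_j g(G_j) for one
    fixed measurable g. *)
Definition window (R : realType) (alpha : R) (I : set R) (x : R) : R :=
  \1_I x * x `^ (- alpha^-1).

Lemma window_in (R : realType) (alpha : R) (I : set R) (x : R) :
  I x -> window alpha I x = x `^ (- alpha^-1).
Proof. by move=> Ix; rewrite /window indicE mem_set// mul1r. Qed.

Lemma window_out (R : realType) (alpha : R) (I : set R) (x : R) :
  ~ I x -> window alpha I x = 0.
Proof. by move=> Ix; rewrite /window indicE memNset// mul0r. Qed.

Lemma measurable_window (R : realType) (alpha : R) (I : set R) :
  measurable I -> measurable_fun setT (window alpha I).
Proof. by move=> mI; apply: measurable_funM => //; exact: measurable_powR. Qed.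

Lemma shot_noise_window (T : Type) (R : realType) (alpha : R)
    (W G : nat -> T -> R) (I : set R) (w : T) :
  shot_noise alpha W G I w = \sum_(j \in setT) W j w * window alpha I (G j w).
Proof.
rewrite /shot_noise fsbig_mkcond; apply: eq_fsbigr => j _; rewrite patchE.
case: ifPn => [|/negP h]; first by rewrite inE/= => Ij; rewrite window_in.
by rewrite window_out ?mulr0// => Ij; apply: h; rewrite inE.
Qed.

(* The point 0 is immaterial because 0 `^ (- alpha^-1) = 0. *)
Lemma shot_noise_itv0 (T : Type) (R : realType) (alpha c : R)
    (W G : nat -> T -> R) : alpha != 0 ->
  shot_noise alpha W G `[0, c] = shot_noise alpha W G `]0, c].
Proof.
move=> a0; apply/funext => w; rewrite !shot_noise_window; apply: eq_fsbigr => j _.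
congr (_ * _); rewrite /window !indicE.
have [->|x0] := eqVneq (G j w) 0.
  by rewrite powR0 ?mulr0// oppr_eq0 invr_eq0.
congr (_%:R * _); congr nat_of_bool; apply/idP/idP; rewrite !inE/= !in_itv/=.
  by rewrite le_eqVlt eq_sym (negbTE x0).
by move=> /andP[/ltW -> ->].
Qed.

Lemma shot_noise_sum (T : Type) (R : realType) (alpha : R)
    (W G : nat -> T -> R) (I : set R) (w : T) (n : nat) :
  (forall j, (n <= j)%N -> W j w * window alpha I (G j w) = 0) ->
  shot_noise alpha W G I w = \sum_(j < n) W j w * window alpha I (G j w).
Proof.
move=> h; rewrite shot_noise_window (fsbig_ord _ n (fun j => W j w * window alpha I (G j w))).
apply/esym; apply: fsbig_widen => // j [_ /=] /negP; rewrite -leqNgt.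
exact: h.
Qed.

(** Realises the finite-support sum as a pointwise limit of measurable functions: partial sums cut
    off by the event [A n] that all terms from n on vanish. *)
Lemma measurable_shot_noise d (T : measurableType d) (R : realType) (alpha : R)
    (W G : nat -> T -> R) (I : set R) :
  (forall j, measurable_fun setT (W j)) -> (forall j, measurable_fun setT (G j)) ->
  measurable I -> measurable_fun setT (shot_noise alpha W G I).
Proof.
move=> mW mG mI.
pose F j w := W j w * window alpha I (G j w).
have mF j : measurable_fun setT (F j).
  apply: measurable_funM => //.
  by apply: (measurableT_comp (f := window alpha I)) => //; exact: measurable_window.
pose A n := \bigcap_(j in [set j | (n <= j)%N]) (F j @^-1` [set 0]).
have mA n : measurable (A n).
  apply: bigcap_measurableType => j _.
  by rewrite -[X in measurable X]setTI; apply: mF => //; exact: measurable_set1.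
apply: (@measurable_fun_cvg _ _ _ _ (fun n w => (\sum_(j < n) F j w) * \1_(A n) w)).
  move=> n; apply: measurable_funM; last exact: measurable_indic.
  by apply: measurable_sum => j; exact: mF.
move=> w _; have [[m Am]|noA] := pselect (exists m, A m w).
  apply: cvg_near_cst; near=> n.
  have An : A n w.
    move=> j /= nj; apply: Am => /=; apply: leq_trans nj.
    by near: n; exact: nbhs_infty_ge.
  by rewrite indicE mem_set// mulr1 (shot_noise_sum (n := n)).
(* If no tail of terms vanishes, the support is infinite; the sum is then 0 by convention and so is
   every approximant. *)
have -> : shot_noise alpha W G I w = 0.
  rewrite shot_noise_window; apply: fsbig_dflt => fin; apply: noA.
  have [B BE] := finite_fsetP.1 fin.
  exists (\max_(i <- B) i).+1 => j /= Bj; apply/eqP/negPn/negP => Fj.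
  have jB : j \in B.
    have : [set` B] j by rewrite -BE; split => //; exact/eqP.
    by [].
  have : (j <= \max_(i <- B) i)%N
    by exact: (@leq_bigmax_seq _ (enum_fset B) xpredT (fun i => i) j).
  by rewrite leqNgt Bj.
apply: cvg_near_cst; apply: nearW => n.
by rewrite indicE memNset ?mulr0// => An; apply: noA; exists n.
Unshelve. all: by end_near. Qed.

Lemma thinning_bounds (R : realType) (a k x : R) : 0 < k -> 0 <= thinning a k x <= 1.
Proof.
move=> k0; rewrite /thinning; case: (leP x 0) => x0; first by rewrite lexx ler01.
by rewrite expR_ge0 -expR0 ler_expR oppr_le0 mulr_ge0 ?powR_ge0 ?ltW.
Qed.

Lemma thinning_le (R : realType) (a k x y : R) : 0 < a -> 0 < k -> x <= y ->
  thinning a k x <= thinning a k y.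
Proof.
move=> a0 k0; rewrite le_eqVlt => /predU1P[-> //|xy].
have /andP[y0 _] := thinning_bounds a y k0.
rewrite {1}/thinning; case: (leP x 0) => // x0.
by rewrite /thinning (leNgt y 0) (lt_trans x0 xy)/= ler_expR lerN2 ltW// decay_lt.
Qed.

(** Continuity from above: [X] has finite values, so the events decrease to the empty set. *)
Lemma poisson_tail_cvg0 d (T : measurableType d) (R : realType)
    (P : probability T R) (X : {mfun T >-> nat}) :
  fine (P [set w | (n < X w)%N]) @[n --> \oo] --> 0.
Proof.
have mX := measurable_tail X.
have cap0 : \bigcap_n [set w | (n < X w)%N] = set0.
  by apply/seteqP; split => // w /(_ (X w) I) /=; rewrite ltnn.
apply: fine_cvg.
rewrite [X in _ --> X](_ : _ = P set0) -?cap0 ?measure0//; last first.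
  by rewrite cap0 measure0.
apply: (nonincreasing_cvg_mu (F := fun n => [set w | (n < X w)%N])) => //.
- by rewrite ltey_eq fin_num_measure.
- by rewrite cap0.
- by move=> m n mn; apply/subsetPset => w /=; exact: leq_ltn_trans.
Qed.

(** Letting I vary between ]p, q'] and ]p, q] covers both ]0, c], with q' = q, and ]c, D[. The
    passage from n terms to the full sum costs at most 2 P(N q > n), because the two cosines differ
    only on that event, up to a null set. *)
Lemma shot_noise_cos_bounds d (T : measurableType d) (R : realType)
    (P : probability T R) (N : R -> {RV P >-> nat}) (G W : nat -> {RV P >-> R})
    (alpha sigma s p q' q : R) (K : R -> R) (I : set R) :
  let a := alpha / 2 in
  let k := sigma ^+ 2 * s ^+ 2 / 2 in
  let X := shot_noise alpha W G I in
  0 < alpha -> 0 < sigma -> s != 0 ->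
  poisson_process 1 N -> arrival_times N G -> iid_centered_normal sigma W ->
  independent_families P (fun j => W j : T -> R) (fun j => G j : T -> R) ->
  0 <= p -> p < q' -> q' <= q -> measurable I ->
  `]p, q'] `<=` I -> I `<=` `]p, q] ->
  (forall x y, p <= x -> x <= y ->
    (1 - thinning a k y) * (y - x) <= K y - K x <= (1 - thinning a k x) * (y - x)) ->
  \int[P]_w sin (s * X w) = 0 /\
  expR (- (K q - K p)) <= \int[P]_w cos (s * X w) <= expR (- (K q' - K p)).
Proof.
move=> a k X al0 sg0 s0 hN hG hW hWG p0 pq' q'q mI I1 I2 slope.
have k0 : 0 < k by rewrite divr_gt0// mulr_gt0// exprn_even_gt0//= gt_eqF.
have a0 : 0 < a by rewrite divr_gt0.
have mg := measurable_window alpha mI.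
pose psi x := expR (- (sigma ^+ 2 * (s * window alpha I x) ^+ 2 / 2)).
(* Squaring x^(-1/alpha) gives the exponent - 2 / alpha = - 1 / a. *)
have psi_in x : 0 < x -> I x -> psi x = thinning a k x.
  move=> x0 Ix; rewrite /psi window_in// /thinning (leNgt x 0) x0/= /decay /k.
  congr (expR (- _)); rewrite exprMn -[(x `^ _) ^+ 2]powR_mulrn ?powR_ge0// -powRrM.
  rewrite [X in x `^ X](_ : _ = - a^-1); last by rewrite /a; field; rewrite gt_eqF.
  by ring.
have psi_out x : ~ I x -> psi x = 1.
  by move=> Ix; rewrite /psi window_out// mulr0 expr0n/= mulr0 mul0r oppr0 expR0.
pose B n := \int[P]_w (\prod_(j < n) psi (G j w)).
(* Taken at q rather than q', so that one error term dominates the tails at both points. *)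
pose eps n := fine (P [set w | (n < N q w)%N]).
have Bbounds n : expR (- (K q - K p)) <= B n <= expR (- (K q' - K p)) + eps n.
  have /andP[h1 h2] : expR (- (K q - K p)) <= B n <=
      expR (- (K q' - K p)) + fine (P [set w | (n < N q' w)%N]).
    apply: (thinned_product_bounds (th := thinning a k) n hN hG p0 pq' q'q _ _ slope).
    - by move=> x; exact: thinning_bounds.
    - by move=> x y _; exact: thinning_le.
    - apply: measurableT_comp => //; apply: measurableT_comp => //.
      apply: measurable_funM => //; apply: measurable_funM => //.
      by apply: measurable_funX; exact: measurable_funM.
    - move=> x; rewrite expR_ge0 -expR0 ler_expR oppr_le0 mulr_ge0// mulr_ge0 ?sqr_ge0//.
    - move=> x xp; apply: psi_in; first by case/andP: xp => /(le_lt_trans p0).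
      by apply: I1; rewrite /= in_itv.
    - move=> x /andP[px _]; have [Ix|nIx] := pselect (I x).
        by rewrite psi_in// (le_lt_trans p0).
      by rewrite psi_out//; case/andP: (thinning_bounds a x k0).
    - move=> x /negP h; apply: psi_out => Ix; apply: h.
      by have := I2 x Ix; rewrite /= in_itv.
  rewrite h1 (le_trans h2)// lerD2l /eps -!(Rintegral_probability_indic P)//;
    try exact: measurable_tail.
  apply: (@ae_le_Rintegral _ _ _ P _ _ 1).
  - by apply: measurable_indic; exact: measurable_tail.
  - by apply: measurable_indic; exact: measurable_tail.
  - by move=> w; rewrite indicE; case: (_ \in _); rewrite ?lexx ?ler01.
  - by move=> w; rewrite indicE; case: (_ \in _); rewrite ?lexx ?ler01.
  apply: filterS (arrivals_counted hN hG) => w [ndw _].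
  rewrite !indicE ler_nat; case: (boolP (w \in [set w | (n < N q' w)%N])) => //.
  rewrite inE/= => nN; rewrite mem_set//=.
  by apply: leq_trans nN _; apply: ndw => //; rewrite (le_trans p0)// ltW.
have mX : measurable_fun setT X.
  by apply: measurable_shot_noise => // j; exact: measurable_funPT.
have mS n : measurable_fun setT (fun w => \sum_(j < n) W j w * window alpha I (G j w)).
  apply: measurable_sum => j; apply: measurable_funM => //.
  by apply: (measurableT_comp (f := window alpha I)).
have near_sum : forall th n,
    `|(\int[P]_w cos (s * X w + th)) - cos th * B n| <= 2 * eps n.
  move=> th n.
  rewrite -(gaussian_peeling th s n (lt0r_neq0 sg0) hW hWG mg).
  have bd (Z : T -> R) : measurable_fun setT Z ->
      measurable_fun setT (fun w => cos (s * Z w + th)).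
    by move=> mZ; exact: (measurableT_comp (measurable_cos_affine s th) mZ).
  have iX := integrable_bounded P (bd _ mX) (fun w => cos_max _).
  have iS := integrable_bounded P (bd _ (mS n)) (fun w => cos_max _).
  have mD := measurable_funB (bd _ mX) (bd _ (mS n)).
  rewrite -RintegralB//; apply: (le_trans (le_normr_Rintegral _ (integrableB _ iX iS))) => //.
  have mind := measurable_indic (measurable_tail (N q) n).
  rewrite /eps -(Rintegral_probability_indic P (measurable_tail (N q) n)).
  rewrite -RintegralZl//; last by apply: integrable_indic; exact: measurable_tail.
  apply: (@ae_le_Rintegral _ _ _ P _ _ 2).
  - exact: measurableT_comp.
  - exact: measurable_funM.
  - move=> w; rewrite normr_ge0 (le_trans (ler_normB _ _))//.
    by rewrite -[leRHS]/(1 + 1) lerD// cos_max.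
  - by move=> w; rewrite indicE; case: (_ \in _) => /=; apply/andP; split; lra.
  apply: filterS (arrivals_counted hN hG) => w [ndw Gw].
  have [nN|Nn] := ltnP n (N q w).
    rewrite indicE mem_set//= mulr1 (le_trans (ler_normB _ _))//.
    by rewrite -[leRHS]/(1 + 1) lerD// cos_max.
  rewrite indicE memNset ?mulr0; last by rewrite /= ltnNge Nn.
  rewrite {1}/X (shot_noise_sum (n := n)) ?subrr ?normr0// => j nj.
  rewrite window_out ?mulr0// => /I2; rewrite /= in_itv/= Gw//; last first.
    by rewrite (le_trans (ltW pq')).
  by rewrite ltnNge (leq_trans Nn nj) andbF.
have eps0 : eps n @[n --> \oo] --> 0 by exact: poisson_tail_cvg0.
have sinE : \int[P]_w sin (s * X w) = 0.
  apply/eqP; rewrite -normr_le0.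
  have cvg2 : 2 * eps n @[n --> \oo] --> 0.
    by rewrite -[X in _ --> X](mulr0 2); exact: cvgMr.
  apply: (cvgr_to_ge cvg2); apply: nearW => n.
  have := near_sum (- (pi / 2)) n.
  rewrite cosN cos_pihalf mul0r subr0.
  by under eq_Rintegral do rewrite cosBpihalf.
split => //; have nb n := near_sum 0 n.
have cvgC (l c : R) : l + c * eps n @[n --> \oo] --> l.
  by rewrite -[X in _ --> X]addr0; apply: cvgD; [exact: cvg_cst|
    rewrite -[X in _ --> X](mulr0 c); exact: cvgMr].
have {}nb : forall n, `|(\int[P]_w cos (s * X w)) - B n| <= 2 * eps n.
  move=> n; have := nb n; rewrite cos0 mul1r.
  by under eq_Rintegral do rewrite addr0.
apply/andP; split.
- apply: (cvgr_to_le (cvgC (expR (- (K q - K p))) (- 2))); apply: nearW => n.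
  by have := nb n; have /andP[h1 h2] := Bbounds n; rewrite ler_norml => /andP[]; lra.
(* The constant 3 is 2 from [nb] plus 1 from the upper half of [Bbounds], whose lower half has no
   error term. *)
- apply: (cvgr_to_ge (cvgC (expR (- (K q' - K p))) 3)); apply: nearW => n.
  by have := nb n; have /andP[h1 h2] := Bbounds n; rewrite ler_norml => /andP[]; lra.
Qed.

(** * The two characteristic functions *)

Lemma char_fun_real d (T : measurableType d) (R : realType) (P : probability T R)
    (X : T -> R) (s r : R) :
  \int[P]_w cos (s * X w) = r -> \int[P]_w sin (s * X w) = 0 ->
  char_fun P X s = r%:C%C.
Proof.
move=> cosE sinE; rewrite /char_fun /complex_expectation.
have -> : fine 'E_P[fun w => complex.Re (expi (s * X w))] = r by rewrite unlock -cosE.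
have -> // : fine 'E_P[fun w => complex.Im (expi (s * X w))] = 0 by rewrite unlock -sinE.
Qed.

Lemma char_fun0 d (T : measurableType d) (R : realType) (P : probability T R)
    (X : T -> R) : char_fun P X 0 = 1%:C%C.
Proof.
by apply: char_fun_real; under eq_Rintegral do rewrite mul0r ?cos0 ?sin0;
  rewrite Rintegral_cst//= probability_setT ?mulr1 ?mul0r.
Qed.

(** Identifies u with [decay] at c. Applied to s / sqrt S2 instead of s, it identifies w in the same
    way. *)
Lemma scale_parameter (R : realType) (alpha c sigma s : R) :
  0 < alpha -> alpha < 2 -> 0 < c ->
  (1 - alpha / 2) / (alpha / 2) * s ^+ 2 / (2 * c) *
    (sigma ^+ 2 * (alpha / (2 - alpha)) * c `^ ((alpha - 2) / alpha)) =
  decay (alpha / 2) (sigma ^+ 2 * s ^+ 2 / 2) c.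
Proof.
move=> al0 al2 c0; rewrite /decay.
have -> : (alpha - 2) / alpha = 1 + - (alpha / 2)^-1 by field; rewrite gt_eqF.
rewrite powRD; last by apply/implyP => _; rewrite gt_eqF.
rewrite powRr1 1?ltW//; field.
by rewrite subr_eq0 !gt_eqF.
Qed.

(** Trades the prefactor k^a of the primitives for c u^a or c w^a, as in the stated formulas. *)
Lemma decay_weight (R : realType) (a k x : R) : 0 < a -> 0 < k -> 0 < x ->
  k `^ a = x * decay a k x `^ a.
Proof.
move=> a0 k0 x0; rewrite /decay powRM ?powR_ge0 ?ltW// -powRrM mulNr mulVf ?gt_eqF//.
by rewrite powRN powRr1 ?ltW// mulrCA divff ?mulr1// gt_eqF.
Qed.

Theorem lemma4 (R : realType) (d : measure_display) (T : measurableType d)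
    (P : probability T R) (N : R -> {RV P >-> nat}) (G W : nat -> {RV P >-> R})
    (alpha c sigmaW s : R)
    (halpha0 : 0 < alpha) (halpha2 : alpha < 2) (halpha1 : alpha != 1)
    (hc : 0 < c) (hsigmaW : 0 < sigmaW)
    (hN : poisson_process 1 N) (hG : arrival_times N G)
    (hW : iid_centered_normal sigmaW W)
    (hWG : independent_families P (fun j => W j : T -> R) (fun j => G j : T -> R)) :
  let a := alpha / 2 in
  let eta := (1 - a) / a in
  let w := eta * s ^+ 2 / (2 * c) in
  let S2 := sigmaW ^+ 2 * (alpha / (2 - alpha)) * c `^ ((alpha - 2) / alpha) in
  let u := w * S2 in
  let X := shot_noise alpha W G `[0, c] in
  (forall (d' : measure_display) (T' : measurableType d') (P' : probability T' R)
      (Rinf : {RV P' >-> R}),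
    cvg_in_distribution P (fun D => shot_noise alpha W G `]c, D[) P' Rinf ->
    let Z := fun w' => Rinf w' / Num.sqrt S2 in
    char_fun P' Z s =
      (expR (c * (1 - expR (- w) - w `^ a * lower_gamma (1 - a) w)))%:C%C)
  /\
  char_fun P X s =
    (expR (- c * (1 - expR (- u) + u `^ a * upper_gamma (1 - a) u)))%:C%C.
Proof.
move=> a eta w S2 u X.
have a0 : 0 < a by rewrite divr_gt0.
have a1 : a < 1 by rewrite ltr_pdivrMr// mul1r.
have S20 : 0 < S2 by rewrite !mulr_gt0 ?exprn_gt0 ?powR_gt0 ?invr_gt0 ?subr_gt0.
(* At s = 0 the parameter k vanishes and the primitives do not apply; both sides are 1 because 0^a =
   0. *)
have [s0|s0] := eqVneq s 0.
  have w0 : w = 0 by rewrite /w s0 expr0n/= mulr0 mul0r.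
  have u0 : u = 0 by rewrite /u w0 mul0r.
  have zero : 0 `^ a = 0 :> R by rewrite powR0// gt_eqF.
  split; last by rewrite u0 s0 char_fun0 zero oppr0 expR0 subrr mul0r addr0 mulr0 expR0.
  move=> d' T' P' Rinf _ Z.
  by rewrite w0 s0 char_fun0 zero oppr0 expR0 subrr mul0r subr0 mulr0 expR0.
split; last first.
  have k0 : 0 < sigmaW ^+ 2 * s ^+ 2 / 2.
    by rewrite divr_gt0// mulr_gt0// exprn_even_gt0//= gt_eqF.
  have uE : u = decay a (sigmaW ^+ 2 * s ^+ 2 / 2) c by exact: scale_parameter.
  have := @shot_noise_cos_bounds _ _ _ P N G W alpha sigmaW s 0 c c
    (near_primitive a (sigmaW ^+ 2 * s ^+ 2 / 2)) `]0, c] halpha0 hsigmaW s0 hN hG hW hWG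
    (lexx 0) hc (lexx c) (measurable_itv _) (@subset_refl _ _) (@subset_refl _ _)
    (near_primitive_slope a0 k0).
  rewrite -/a -shot_noise_itv0 ?gt_eqF// => -[sinE cosE].
  apply: char_fun_real => //.
  (* Here q' = q = c, so the two bounds coincide and determine the value. *)
  move: cosE; rewrite -eq_le => /eqP <-; congr expR.
  rewrite /near_primitive lexx (leNgt c 0) hc/= -uE subr0.
  rewrite (decay_weight a0 k0 hc) -uE; ring.
move=> d' T' P' Rinf hcvg Z.
(* The characteristic function of Z at s is that of the tail sum at s'. *)
pose s' := s / Num.sqrt S2.
have sq0 : 0 < Num.sqrt S2 by rewrite sqrtr_gt0.
have s'0 : s' != 0 by rewrite mulf_neq0// invr_neq0// gt_eqF.
pose k := sigmaW ^+ 2 * s' ^+ 2 / 2.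
have k0 : 0 < k by rewrite divr_gt0// mulr_gt0// exprn_even_gt0//= gt_eqF.
have wE : w = decay a k c.
  have s'2 : s' ^+ 2 = s ^+ 2 / S2 by rewrite /s' expr_div_n sqr_sqrtr// ltW.
  rewrite /k -scale_parameter// -/a -/eta -/S2 s'2.
  by rewrite /w; field; rewrite !gt_eqF.
pose L x := far_primitive a k x.
have LcE : L c = c * (1 - expR (- w) - w `^ a * lower_gamma (1 - a) w).
  by rewrite /L /far_primitive -wE (decay_weight a0 k0 hc) -wE; ring.
(* The choice q' = D - 1 keeps ]c, q'] inside the open window, and c + 1 < D ensures c < q'. *)
have bounds D : c + 1 < D ->
    \int[P]_w sin (s' * shot_noise alpha W G `]c, D[ w) = 0 /\
    expR (- (L D - L c)) <= \int[P]_w cos (s' * shot_noise alpha W G `]c, D[ w) <=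
    expR (- (L (D - 1) - L c)).
  move=> cD; apply: (@shot_noise_cos_bounds _ _ _ P N G W alpha sigmaW s' c (D - 1) D L) => //.
  - exact: ltW.
  - by rewrite ltrBrDr.
  - by rewrite gerBl.
  - move=> x; rewrite /= !in_itv/= => /andP[-> /le_lt_trans ->//].
    by rewrite gtrBl.
  - by move=> x; rewrite /= !in_itv/= => /andP[-> /ltW].
  - move=> x y cx; exact: (far_primitive_slope a0 a1 k0 (lt_le_trans hc cx)).
have Lcvg := far_primitive_cvg a0 a1 k0.
have cosD : \int[P]_w cos (s' * shot_noise alpha W G `]c, D[ w) @[D --> +oo] --> expR (L c).
  have cvgE (f : R -> R) : f D @[D --> +oo] --> 0 ->
      expR (- (f D - L c)) @[D --> +oo] --> expR (L c).
    move=> f0; apply: continuous_cvg; first exact: continuous_expR.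
    have h : - (f D - L c) @[D --> +oo] --> - (0 - L c).
      by apply: cvgN; apply: (cvgB f0); exact: cvg_cst.
    by rewrite sub0r opprK in h.
  apply: (squeeze_cvgr _ (cvgE L Lcvg) (cvgE (fun D => L (D - 1)) _)).
    near=> D; apply: (bounds D _).2.
    by near: D; exact: (nbhs_pinfty_gt (num_real _)).
  exact: (cvg_comp _ _ (cvg_addrr _) Lcvg).
have mshot D : measurable_fun setT (shot_noise alpha W G `]c, D[).
  apply: measurable_shot_noise => [j|j|]; first exact: measurable_funPT.
    exact: measurable_funPT.
  exact: measurable_itv.
(* Convergence in distribution tested on the bounded continuous function x |-> f (s' x); uniqueness
   of limits gives the expectation under the limit law. *)
have EE (f : R -> R) : continuous f -> (forall x, `|f x| <= 1) ->
    forall l, (\int[P]_w f (s' * shot_noise alpha W G `]c, D[ w) @[D --> +oo] --> l) ->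
    \int[P']_w f (s * Z w) = l.
  move=> cf f1 l fl.
  pose fs (x : R) := f (s' * x).
  have cfs : continuous fs.
    move=> x; apply: (@continuous_comp _ _ _ (fun x => s' * x) f); last exact: cf.
    by apply: cvgMr; exact: cvg_id.
  have bfs : exists M : R, forall x, `|fs x| <= M by exists 1 => x; exact: f1.
  have h := hcvg _ cfs bfs.
  have fZ : \int[P']_w f (s * Z w) = fine 'E_P'[fs \o Rinf].
    rewrite unlock; apply: eq_Rintegral => x _; rewrite /fs/=; congr f.
    by rewrite /Z /s'; ring.
  have E2 : 'E_P'[fs \o Rinf]%E = l%:E.
    apply: (cvg_unique _ h) => //.
    have -> : (fun D => 'E_P[fs \o shot_noise alpha W G `]c, D[])%E =
        (fun D => (\int[P]_w fs (shot_noise alpha W G `]c, D[ w))%:E).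
      apply/funext => D; rewrite unlock /Rintegral fineK//.
      have mfs : measurable_fun setT fs.
        exact: continuous_measurable_fun.
      exact: (integrable_fin_num _ (integrable_bounded P (measurableT_comp mfs (mshot D))
        (fun w => f1 _))).
    by apply: cvg_EFin => //; exact: nearW.
  by rewrite fZ E2.
apply: char_fun_real.
  by rewrite -LcE; apply: EE => //; [exact: continuous_cos|exact: cos_max].
apply: EE => //; [exact: continuous_sin|exact: sin_max|].
apply: cvg_near_cst; near=> D; apply: (bounds D _).1.
by near: D; exact: (nbhs_pinfty_gt (num_real _)).
Unshelve. all: by end_near. Qed.
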